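(* In the setting described in the context, let $\mathcal{X}_t(\{\bm{x}_0\})$ be the integrator reach set with time-varying input range $[u_{\min}(s),u_{\max}(s)]$, $s\in[0,t]$. Then every boundary point $\bm{x}^{\rm bdy}\in\partial\mathcal{X}_t(\{\bm{x}_0\})$ admits the parameterization, for some $\bm{\sigma}=(\sigma_1,\dots,\sigma_{n-1})\in\mathcal{W}_t$ and some choice of overall sign $\epsilon\in\{+1,-1\}$, $$\bm{x}^{\rm bdy}(\bm{\sigma})=\bm{\chi}(t,\bm{x}_0)+\int_0^t\nu(s)\bm{\xi}(t-s)\,{\rm d}s+\epsilon\sum_{i=1}^{n}(-1)^{i-1}\int_{\sigma_{i-1}}^{\sigma_i}\mu(s)\bm{\xi}(t-s)\,{\rm d}s,$$ with the convention $\sigma_0:=0$, $\sigma_n:=t$.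
   Context: Let $\bm{A}\in\mathbb{R}^{n\times n}$, $\bm{b}\in\mathbb{R}^n$ with $(\bm{A},\bm{b})$ controllable and $\bm{A}$ having $n$ distinct eigenvalues; let $v_{\min}\le v_{\max}$ be constants, $\bm{z}_0\in\mathbb{R}^n$, $t>0$, and $\bm{x}_0:=\bm{M}\bm{z}_0$. Here $\bm{C}=(\bm{b},\bm{A}\bm{b},\dots,\bm{A}^{n-1}\bm{b})$, $\bm{q}^\top$ is the last row of $\bm{C}^{-1}$, $\bm{M}$ has rows $\bm{q}^\top,\bm{q}^\top\bm{A},\dots,\bm{q}^\top\bm{A}^{n-1}$; $\bm{c}=(c_0,\dots,c_{n-1})^\top$ are the coefficients of the characteristic polynomial $\lambda^n+c_{n-1}\lambda^{n-1}+\dots+c_0$ of $\bm{A}$; $\bm{A}_{\rm con}=\bm{M}\bm{A}\bm{M}^{-1}$ is the companion matrix with first $n-1$ rows $(\bm{0}\ \bm{I}_{n-1})$ and last row $-\bm{c}^\top$; $\bm{b}_{\rm con}=(0,\dots,0,1)^\top$; $\bm{A}_{\rm int}$ has first $n-1$ rows $(\bm{0}\ \bm{I}_{n-1})$ and last row zero. For $0\le s\le t$, with $f(\tau)=\langle\bm{c},e^{(s-\tau)\bm{A}_{\rm con}}\bm{b}_{\rm con}\rangle$ and $I(v)=v(s)-\int_0^s f(\tau)v(\tau)\,{\rm d}\tau$, let $I_{\min}(s),I_{\max}(s)$ be the inf and sup of $I(v)$ over $v\in C([0,s])$ with $v_{\min}\le v\le v_{\max}$, and $u_{\min}(s)=-\langle\bm{c},e^{s\bm{A}_{\rm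 con}}\bm{M}\bm{z}_0\rangle+I_{\min}(s)$, $u_{\max}(s)=-\langle\bm{c},e^{s\bm{A}_{\rm con}}\bm{M}\bm{z}_0\rangle+I_{\max}(s)$. The integrator reach set $\mathcal{X}_t(\{\bm{x}_0\})$ is the set of $\bm{x}(t)$ with $\dot{\bm{x}}=\bm{A}_{\rm int}\bm{x}+\bm{b}_{\rm con}u$, $\bm{x}(0)=\bm{x}_0$, $u\in C([0,t])$, $u_{\min}(s)\le u(s)\le u_{\max}(s)$ for all $s$. Define $\mu(s):=(u_{\max}(s)-u_{\min}(s))/2$, $\nu(s):=(u_{\max}(s)+u_{\min}(s))/2$, $\bm{\xi}(s):=\big(\tfrac{s^{n-1}}{(n-1)!},\tfrac{s^{n-2}}{(n-2)!},\dots,s,1\big)^\top$, and $\bm{\chi}(t,\bm{x}_0)\in\mathbb{R}^n$ componentwise by $\chi_k=\sum_{\ell=k}^{n}\frac{t^{\ell-k}}{(\ell-k)!}x_{\ell0}$, $k=1,\dots,n$, where $x_{\ell 0}$ is the $\ell$-th component of $\bm{x}_0$. The Weyl chamber is $\mathcal{W}_t:=\{\bm{\sigma}\in\mathbb{R}^{n-1}\mid 0\le\sigma_1\le\dots\le\sigma_{n-1}\le t\}$. *)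

(* Defs.v *)
From HB Require Import structures.
From mathcomp Require Import all_boot all_order all_algebra.
From mathcomp Require Import all_classical all_reals all_analysis.
From mathcomp Require Import complex.
Set Implicit Arguments. Unset Strict Implicit. Unset Printing Implicit Defensive.
Import Order.TTheory GRing.Theory Num.Theory.
Import numFieldNormedType.Exports.
Local Open Scope classical_set_scope.
Local Open Scope ring_scope.

Section Defs.
Variable R : realType.

Definition expmx (m : nat) (A : 'M[R]_m) : 'M[R]_m :=
  \matrix_(i, j) limn (series (fun k => (A ^+ k) i j / (k`!)%:R)).

Definition ctrb (m : nat) (A : 'M[R]_m) (b : 'cV[R]_m) : 'M[R]_m :=
  \matrix_(i, j) ((A ^+ j *m b) i 0).

Definition controllable (m : nat) (A : 'M[R]_m) (b : 'cV[R]_m) : Prop :=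
  \rank (ctrb A b) = m.

Definition distinct_eigenvalues (m : nat) (A : 'M[R]_m) : Prop :=
  exists lam : m.-tuple R[i],
    uniq lam /\
    map_poly (fun x : R => Complex x 0) (char_poly A) = \prod_(l <- lam) ('X - l%:P).

Definition qrow (n : nat) (A : 'M[R]_n.+1) (b : 'cV[R]_n.+1) : 'rV[R]_n.+1 :=
  row ord_max (invmx (ctrb A b)).

Definition Mmat (n : nat) (A : 'M[R]_n.+1) (b : 'cV[R]_n.+1) : 'M[R]_n.+1 :=
  \matrix_(i, j) ((qrow A b *m A ^+ i) 0 j).

Definition ccoef (m : nat) (A : 'M[R]_m) : 'cV[R]_m :=
  \col_(k < m) (char_poly A)`_k.

Definition Acon (n : nat) (A : 'M[R]_n.+1) : 'M[R]_n.+1 :=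
  \matrix_(i, j) (if i == ord_max then - (ccoef A) j 0
                  else ((j : nat) == i.+1)%:R).

Definition bcon (n : nat) : 'cV[R]_n.+1 := \col_(i < n.+1) ((i == ord_max)%:R).

Definition Aint (n : nat) : 'M[R]_n.+1 :=
  \matrix_(i, j) (((j : nat) == i.+1)%:R).

Definition dotv (m : nat) (x y : 'cV[R]_m) : R := (x^T *m y) 0 0.

Definition Rint (a b : R) (f : R -> R) : R :=
  Rintegral (@lebesgue_measure R) `[a, b] f.

Definition fker (n : nat) (A : 'M[R]_n.+1) (s tau : R) : R :=
  dotv (ccoef A) (expmx ((s - tau) *: Acon A) *m bcon n).

Definition admissible (vmin vmax s : R) (v : R -> R) : Prop :=
  {within `[0, s], continuous v} /\
  (forall tau, 0 <= tau <= s -> vmin <= v tau <= vmax).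

Definition Ifun (n : nat) (A : 'M[R]_n.+1) (s : R) (v : R -> R) : R :=
  v s - Rint 0 s (fun tau => fker A s tau * v tau).

Definition Iset (n : nat) (A : 'M[R]_n.+1) (vmin vmax s : R) : set R :=
  [set Ifun A s v | v in admissible vmin vmax s].

Definition Imin n A vmin vmax s : R := inf (@Iset n A vmin vmax s).
Definition Imax n A vmin vmax s : R := sup (@Iset n A vmin vmax s).

Definition umin (n : nat) (A : 'M[R]_n.+1) (b : 'cV[R]_n.+1)
  (vmin vmax : R) (z0 : 'cV[R]_n.+1) (s : R) : R :=
  - dotv (ccoef A) (expmx (s *: Acon A) *m (Mmat A b *m z0))
  + Imin A vmin vmax s.

Definition umax (n : nat) (A : 'M[R]_n.+1) (b : 'cV[R]_n.+1)
  (vmin vmax : R) (z0 : 'cV[R]_n.+1) (s : R) : R :=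
  - dotv (ccoef A) (expmx (s *: Acon A) *m (Mmat A b *m z0))
  + Imax A vmin vmax s.

Definition reach_set (n : nat) (ulo uhi : R -> R) (t : R)
  (x0 : 'cV[R]_n.+1) : set 'cV[R]_n.+1 :=
  [set y | exists (u : R -> R) (x : R -> 'cV[R]_n.+1),
     [/\ {within `[0, t], continuous u},
         (forall s, 0 <= s <= t -> ulo s <= u s <= uhi s),
         {within `[0, t], continuous x} /\ x 0 = x0,
         (forall s, 0 < s < t -> is_derive s (1 : R) x (Aint n *m x s + u s *: bcon n))
       & y = x t]].

Definition boundary (T : topologicalType) (X : set T) : set T :=
  closure X `\` interior X.

(* xi(s) = (s^{m-1}/(m-1)!, ..., s, 1)^T, m = n.+1 (0-indexed component k
   is s^(n-k)/(n-k)!) *)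
Definition xi (n : nat) (s : R) : 'cV[R]_n.+1 :=
  \col_(k < n.+1) (s ^+ (n - k) / ((n - k)`!)%:R).

Definition chi (n : nat) (t : R) (x0 : 'cV[R]_n.+1) : 'cV[R]_n.+1 :=
  \col_(k < n.+1) \sum_(l < n.+1 | (k <= l)%N)
      (t ^+ (l - k) / ((l - k)`!)%:R * x0 l 0).

Definition weyl (n : nat) (t : R) : set ('I_n -> R) :=
  [set sg | (forall i : 'I_n, 0 <= sg i <= t) /\
            (forall i j : 'I_n, (i <= j)%N -> sg i <= sg j)].

(* sigma_i for i = 0..m with sigma_0 = 0, sigma_m = t, sigma_i = sg (i-1) *)
Definition sigext (n : nat) (t : R) (sg : 'I_n -> R) (i : nat) : R :=
  if i is j.+1 then (if @insub _ (fun k => (k < n)%N) 'I_n j is Some k then sg k else t)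
  else 0.

Definition Rintv (n : nat) (a b : R) (g : R -> 'cV[R]_n.+1) : 'cV[R]_n.+1 :=
  \col_(k < n.+1) Rint a b (fun s => g s k 0).

End Defs.

(* Main.v *)
Require Import Defs.
From HB Require Import structures.
From mathcomp Require Import all_boot all_order all_algebra.
From mathcomp Require Import all_classical all_reals all_analysis.
From mathcomp Require Import ring lra.
Import Order.TTheory GRing.Theory Num.Theory.
Import numFieldNormedType.Exports.
Local Open Scope classical_set_scope.
Local Open Scope ring_scope.
Set Implicit Arguments. Unset Strict Implicit. Unset Printing Implicit Defensive.

(** Iterated integration gives [x(t) = chi + int_0^t u(s) xi(t-s) ds], so the reach
set is convex and a boundary point [xb] has a supporting functional [eta <> 0].
The weight [p(s) = <eta, xi(t-s)>] is a nonzero polynomial of degree at most [n],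
hence changes sign at most [n] times on [[0,t]]; the switching times, padded with
[t], are the [sigma_i].  The admissible inputs [nu + mu p/(|p|+d)] show that [xb]
is at least as extreme as the bang-bang point [x*] in the direction [eta].
Conversely, if reachable points with inputs [u_k] tend to [xb], then
[int |u* - u_k| |p|] tends to [0]; since [p] vanishes only finitely often, so does
[int |u* - u_k|], and [xb = x*].  Continuity of [u_min] and [u_max] comes from
reversing time in the integral defining [I(v)]. *)

(** * Supporting hyperplanes *)

(* Induction on the number of coordinates: a functional that is nonnegative on the
   slice [x k = 0] extends to all of [D] with a coefficient chosen by a supremum. *)
Lemma separation_nat (R : realType) (k : nat) (D : set (nat -> R)) :
  D !=set0 ->
  (forall x y a b, D x -> D y -> 0 <= a -> 0 <= b -> a + b = 1 ->
     D (fun i => a * x i + b * y i)) ->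
  (forall x, D x -> exists2 i, (i < k)%N & x i != 0) ->
  exists2 eta : nat -> R, exists2 i, (i < k)%N & eta i != 0 &
    forall x, D x -> 0 <= \sum_(i < k) eta i * x i.
Proof.
elim: k D => [|k IH] D [z Dz] convD D0; first by have [] := D0 z Dz.
have single (c : R) : c != 0 -> (forall x, D x -> 0 <= c * x k) ->
    exists2 eta : nat -> R, exists2 i, (i < k.+1)%N & eta i != 0 &
      forall x, D x -> 0 <= \sum_(i < k.+1) eta i * x i.
  move=> c0 H; exists (fun i => if i == k then c else 0).
    by exists k => //; rewrite eqxx.
  move=> x Dx; rewrite big_ord_recr /= eqxx big1 ?add0r; first exact: H.
  by move=> i _; rewrite ltn_eqF// mul0r.
have [Hp|/existsNP[xn /not_implyP[Dxn /negP]]] :=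
  pselect (forall x, D x -> 0 <= x k).
  by apply: (single 1) => [|x /Hp]; rewrite ?oner_neq0 ?mul1r.
rewrite -ltNge => xn0.
have [Hn|/existsNP[xp /not_implyP[Dxp /negP]]] :=
  pselect (forall x, D x -> x k <= 0).
  apply: (single (-1)) => [|x /Hn]; rewrite ?oppr_eq0 ?oner_neq0 //.
  by rewrite mulN1r oppr_ge0.
rewrite -ltNge => xp0.
pose D1 := D `&` [set x | x k = 0].
have cross x y : D x -> D y -> 0 < x k -> y k < 0 ->
    D1 (fun i => - y k / (x k - y k) * x i + x k / (x k - y k) * y i).
  move=> Dx Dy x0 y0; have xy : 0 < x k - y k by lra.
  split; last by rewrite /=; field; rewrite gt_eqF.
  by apply: convD => //; rewrite ?divr_ge0 ?oppr_ge0 ?ltW//; field; rewrite gt_eqF.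
have [] := IH D1.
- exists (fun i => - xn k / (xp k - xn k) * xp i + xp k / (xp k - xn k) * xn i).
  exact: cross.
- move=> x y a b [Dx x0] [Dy y0] a0 b0 ab; split; first exact: convD.
  by rewrite /= x0 y0 !mulr0 addr0.
- move=> x [Dx x0]; have [i] := D0 x Dx.
  rewrite ltnS leq_eqVlt => /predU1P[->|ik xi]; last by exists i.
  by rewrite x0 eqxx.
move=> eta [i0 i0k ei0] Heta.
pose h (x : nat -> R) := \sum_(i < k) eta i * x i.
pose S := [set - h x / x k | x in [set x | D x /\ 0 < x k]].
have Sub x y : D x -> D y -> 0 < x k -> y k < 0 -> - h x / x k <= - h y / y k.
  move=> Dx Dy x0 y0; have := Heta _ (cross x y Dx Dy x0 y0).
  have -> : \sum_(i < k) eta i * (- y k / (x k - y k) * x i + x k / (x k - y k) * y i)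
     = - y k / (x k - y k) * h x + x k / (x k - y k) * h y.
    rewrite /h !mulr_sumr -big_split; apply: eq_bigr => i _ /=; ring.
  have xy : 0 < x k - y k by lra.
  rewrite (_ : _ + _ = (x k * h y - y k * h x) / (x k - y k)); last by ring.
  rewrite pmulr_lge0 ?invr_gt0// => H.
  rewrite ler_pdivrMr// mulrAC ler_ndivlMr//; nra.
have hS : has_sup S.
  split; first by exists (- h xp / xp k); exists xp.
  by exists (- h xn / xn k) => _ [x [Dx x0] <-]; exact: Sub.
exists (fun i => if i == k then sup S else eta i).
  by exists i0; rewrite ?(ltn_eqF i0k)// ltnS ltnW.
move=> x Dx; rewrite big_ord_recr /= eqxx.
rewrite (eq_bigr (fun i : 'I_k => eta i * x i)) => [|i _]; last by rewrite ltn_eqF.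
rewrite -/(h x); have [x0|x0|x0] := ltgtP (x k) 0.
- have : sup S <= - h x / x k.
    by apply: ge_sup; [case: hS | move=> _ [y [Dy y0] <-]; exact: Sub].
  by rewrite ler_ndivlMr//; lra.
- have : - h x / x k <= sup S by apply: sup_ubound; [case: hS | exists x].
  by rewrite ler_pdivrMr//; lra.
- by rewrite x0 mulr0 addr0; apply: Heta.
Qed.

Definition convex_cV (R : realType) (m : nat) (C : set 'cV[R]_m) :=
  forall x y a b, C x -> C y -> 0 <= a -> 0 <= b -> a + b = 1 ->
    C (a *: x + b *: y).

Lemma convex_cV_sum (R : realType) (m k : nat) (C : set 'cV[R]_m)
    (x : nat -> 'cV[R]_m) : convex_cV C ->
  (forall i, (i <= k)%N -> C (x i)) ->
  C ((k.+1%:R)^-1 *: \sum_(i < k.+1) x i).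
Proof.
move=> cC; elim: k => [|k IH] Cx.
  by rewrite big_ord_recl big_ord0 addr0 invr1 scale1r; exact: Cx.
rewrite big_ord_recr /= scalerDr.
have -> : k.+2%:R^-1 *: \sum_(i < k.+1) x i =
    ((k.+1%:R) / (k.+2%:R)) *: ((k.+1%:R)^-1 *: \sum_(i < k.+1) x i).
  by rewrite scalerA mulrAC divff ?mul1r.
apply: cC; rewrite ?divr_ge0 ?invr_ge0 ?ler0n//.
- by apply: IH => i ik; apply: Cx; rewrite leqW.
- exact: Cx.
- by rewrite -[X in _ + X]mul1r -mulrDl natr1 divff.
Qed.

(* Otherwise [C] contains a cross-polytope around [xb]. *)
Lemma not_interior_direction (R : realType) (n : nat) (C : set 'cV[R]_n.+1)
    (xb : 'cV[R]_n.+1) : convex_cV C -> ~ interior C xb ->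
  exists d : 'cV[R]_n.+1, forall e : R, 0 < e -> ~ C (xb + e *: d).
Proof.
move=> cC; apply: contra_notP => /forallNP H.
have {}H (i : 'I_n.+1) : exists2 e : R, 0 < e & forall a, `|a| <= e ->
    C (xb + a *: delta_mx i 0).
  have /existsNP[e1 /not_implyP[e10 /contrapT C1]] := H (delta_mx i 0).
  have /existsNP[e2 /not_implyP[e20 /contrapT C2]] := H (- delta_mx i 0).
  exists (Num.min e1 e2); first by rewrite lt_min e10.
  move=> a; rewrite le_min !ler_norml => /andP[/andP[_ a1] /andP[a2 _]].
  have e12 : 0 < e1 + e2 by lra.
  have -> : xb + a *: delta_mx i 0 =
     ((e2 + a) / (e1 + e2)) *: (xb + e1 *: delta_mx i 0)
     + ((e1 - a) / (e1 + e2)) *: (xb + e2 *: - delta_mx i 0).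
    apply/matrixP => u v; rewrite !mxE.
    by field; rewrite gt_eqF.
  apply: cC => //; rewrite ?divr_ge0//; [lra|lra|lra|lra|].
  by field; rewrite gt_eqF.
pose e i := sval (cid2 (H i)).
have e0 i : 0 < e i by rewrite /e; case: cid2.
have eC i a : `|a| <= e i -> C (xb + a *: delta_mx i 0).
  by rewrite /e; case: cid2 => ? ? /=; apply.
pose r := \big[Num.min/1]_i e i.
have r0 : 0 < r.
  by rewrite /r; elim/big_ind: _ => // x y x0 y0; rewrite lt_min x0.
have re i : r <= e i by rewrite /r; apply: bigmin_le_cond.
rewrite /interior /=; apply/nbhs_ballP; exists (r / n.+1%:R) => /=.
  by rewrite divr_gt0 ?ltr0n.
move=> y /= xy.
have -> : y = (n.+1%:R)^-1 *: \sum_(i < n.+1)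
   (xb + (n.+1%:R * (y (inord i) 0 - xb (inord i) 0)) *: delta_mx (inord i) 0).
  apply/matrixP => u v; rewrite (ord1 v) mxE summxE.
  under eq_bigr do rewrite !mxE inord_val eqxx andbT.
  rewrite big_split /= sumr_const card_ord (bigD1 u)//= eqxx big1; last first.
    by move=> j ju; rewrite eq_sym (negbTE ju) mulr0.
  rewrite addr0 mulr1 -[_ *+ _]mulr_natl.
  by field; rewrite addrC natr1 pnatr_eq0.
apply: (@convex_cV_sum R n.+1 n C (fun i => xb +
  (n.+1%:R * (y (inord i) 0 - xb (inord i) 0)) *: delta_mx (inord i) 0)) => //.
move=> i ik; apply: eC; apply: le_trans (re _).
have [_ /(_ (inord i) 0)] := xy; rewrite /ball /= distrC => /ltW.
rewrite ler_pdivlMr ?ltr0n// => H1.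
by rewrite normrM mulrC normr_nat.
Qed.

Lemma supporting_hyperplane (R : realType) (n : nat) (C : set 'cV[R]_n.+1)
    (xb : 'cV[R]_n.+1) : convex_cV C -> C !=set0 -> ~ interior C xb ->
  exists2 eta : 'I_n.+1 -> R, exists i, eta i != 0 &
    forall x, C x -> \sum_i eta i * x i 0 <= \sum_i eta i * xb i 0.
Proof.
move=> cC [z Cz] /(not_interior_direction cC)[d Hd].
(* Separate [0] from [xb + ]0, +oo[ d - C], then let the multiple of [d] vanish. *)
pose D := [set f : nat -> R | exists x e, [/\ C x, 0 < e &
   f = fun i => xb (inord i) 0 + e * d (inord i) 0 - x (inord i) 0]].
have [] := @separation_nat R n.+1 D.
- by eexists; exists z, 1; split.
- move=> _ _ a b [x [e [Cx e0 ->]]] [y [f [Cy f0 ->]]] a0 b0 ab.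
  exists (a *: x + b *: y), (a * e + b * f); split; first exact: cC.
    have [a00|a1] := eqVneq a 0.
      by rewrite a00 mul0r add0r; apply: mulr_gt0 => //; lra.
    by rewrite ltr_wpDr ?mulr_gt0 ?mulr_ge0 ?(ltW f0)// lt_neqAle eq_sym a1.
  apply/funext => i; rewrite !mxE (_ : b = 1 - a); [ring|lra].
- move=> _ [x [e [Cx e0 ->]]]; apply: contrapT => H; apply: (Hd e e0).
  suff -> : xb + e *: d = x by [].
  apply/matrixP => i j; rewrite (ord1 j) !mxE; apply/eqP; rewrite -subr_eq0.
  apply: contrapT => /negP H1; apply: H; exists i => //.
  by rewrite inord_val.
move=> eta [i0 i0n ei0] Heta; exists (fun i => eta i).
  by exists (Ordinal i0n).
move=> x Cx; set s := \sum_i _ * xb _ _.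
pose w := \sum_(i < n.+1) eta i * d i 0.
have key e : 0 < e -> \sum_(i < n.+1) eta i * x i 0 <= s + e * w.
  move=> e0; rewrite -subr_ge0;
  have := Heta (fun i => xb (inord i) 0 + e * d (inord i) 0 - x (inord i) 0).
  move=> /(_ _)/wrap[]; first by exists x, e; split.
  under eq_bigr do rewrite inord_val mulrBr mulrDr mulrCA.
  by rewrite sumrB big_split -mulr_sumr.
apply/ler_addgt0Pr => e e0.
have w1 : 0 < `|w| + 1 by rewrite ltr_wpDl.
apply: (le_trans (key (e / (`|w| + 1)) _)); first by rewrite divr_gt0.
rewrite lerD2l mulrAC ler_pdivrMr// ler_pM2l//.
by rewrite (le_trans (ler_norm _))// lerDl.
Qed.

(** * Sign changes of a polynomial *)

Lemma poly_split_roots_itv (R : rcfType) (a b : R) (k : nat) (p : {poly R}) :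
  p != 0 -> (size p <= k.+1)%N ->
  exists (rs : seq R) (q : {poly R}), [/\ p = q * \prod_(r <- rs) ('X - r%:P),
    (size rs <= k)%N, {in rs, forall r, a <= r <= b} &
    forall x, a <= x <= b -> q.[x] != 0].
Proof.
elim: k p => [|k IH] p p0 sp; last first.
  have [[x [xab px]]|H] := pselect (exists x, a <= x <= b /\ p.[x] = 0).
    have /factor_theorem[q pq] : root p x by apply/eqP.
    have q0 : q != 0 by apply: contra_neq p0 => q0; rewrite pq q0 mul0r.
    have [||rs [q' [qq' srs rsab q'0]]] := IH q; first exact: q0.
      move: sp; rewrite pq size_Mmonic ?monicXsubC// size_XsubC addn2 /= ltnS.
      exact.
    exists (x :: rs), q'; split => //.
      by rewrite big_cons pq qq' mulrAC mulrA.
    by move=> r; rewrite inE => /predU1P[->|/rsab].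
  exists [::], p; split => //; first by rewrite big_nil mulr1.
  by move=> x xab; apply/eqP => px; apply: H; exists x.
exists [::], p; split => //; first by rewrite big_nil mulr1.
move=> x _; have /size_poly1P[c c0 ->] : size p == 1%N.
  by rewrite eqn_leq sp size_poly_gt0.
by rewrite hornerC.
Qed.

Lemma poly_no_root_sign (R : rcfType) (a b : R) (q : {poly R}) : a <= b ->
  (forall x, a <= x <= b -> q.[x] != 0) ->
  exists2 e : R, e = 1 \/ e = -1 & forall x, a <= x <= b -> 0 < e * q.[x].
Proof.
move=> ab q0; exists (Num.sg q.[a]).
  have := q0 a; rewrite lexx ab => /(_ isT).
  by case: sgrP => // _ _; [left|right].
move=> x /andP[ax xb].
have qa : q.[a] != 0 by rewrite q0 // lexx.
have qx : q.[x] != 0 by rewrite q0 // ax.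
have ivt (p : {poly R}) : p.[a] <= 0 <= p.[x] -> exists2 y, a <= y <= x & p.[y] = 0.
  by move=> /(poly_ivt ax)[y yax /rootP py]; exists y.
case: sgrP qa => // qa _.
- rewrite mul1r ltNge; apply/negP => qx0.
  have [|y /andP[ay yx] /eqP] := ivt (- q).
    by rewrite !hornerN oppr_le0 oppr_ge0 qx0 ltW.
  by rewrite hornerN oppr_eq0; apply/negP; rewrite q0// ay (le_trans yx).
- rewrite mulN1r oppr_gt0 ltNge; apply/negP => qx0.
  have [|y /andP[ay yx] /eqP] := ivt q; first by rewrite qx0 ltW.
  by apply/negP; rewrite q0// ay (le_trans yx).
Qed.

Lemma prod_sorted_sign (R : realDomainType) (s : R) (l : seq R) (i : nat) :
  {in take i l, forall r, r <= s} -> {in drop i l, forall r, s <= r} ->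
  0 <= (-1) ^+ (size l - i) * \prod_(r <- l) (s - r).
Proof.
move=> Hl Hr; rewrite -{2}(cat_take_drop i l) big_cat /= mulrCA mulr_ge0//.
  by rewrite big_seq prodr_ge0// => r /Hl; rewrite subr_ge0.
rewrite -size_drop; elim: (drop i l) Hr => [|r l' IH] Hr.
  by rewrite big_nil mulr1 expr0.
rewrite big_cons /= exprS mulrACA mulr_ge0 ?IH//.
  by rewrite mulN1r opprB subr_ge0 Hr ?mem_head.
by move=> r' r'l; apply: Hr; rewrite inE r'l orbT.
Qed.

Lemma poly_sign_pattern (R : rcfType) (t : R) (n : nat) (p : {poly R}) :
  0 <= t -> p != 0 -> (size p <= n.+1)%N ->
  exists (l : seq R) (e : R), [/\ size l = n, sorted <=%R l,
    {in l, forall r, 0 <= r <= t}, e = 1 \/ e = -1 &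
    forall (i : nat) s, 0 <= s < t -> (i <= n)%N ->
      {in take i l, forall r, r <= s} -> {in drop i l, forall r, s <= r} ->
      0 <= e * (-1) ^+ i * p.[s]].
Proof.
move=> t0 p0 sp.
have [rs [q [pE srs rst q0]]] := @poly_split_roots_itv R 0 t n p p0 sp.
have [e0 e01 He0] := poly_no_root_sign t0 q0.
pose l := sort <=%R (rs ++ nseq (n - size rs) t).
have sl : size l = n by rewrite size_sort size_cat size_nseq subnKC.
exists l, (e0 * (-1) ^+ size rs); split => //.
- exact/sort_sorted/le_total.
- move=> r; rewrite mem_sort mem_cat => /orP[/rst//|].
  by rewrite mem_nseq => /andP[_ /eqP->]; rewrite t0 lexx.
- rewrite -signr_odd; case: odd; case: e01 => ->;
    rewrite ?mulN1r ?mulr1 ?mul1r ?opprK ?expr0 ?expr1; auto.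
move=> i s /andP[s0 st] il Hl Hr.
have := prod_sorted_sign Hl Hr; rewrite sl.
have -> : \prod_(r <- l) (s - r) =
    \prod_(r <- rs) (s - r) * (-1) ^+ (n - size rs) * (t - s) ^+ (n - size rs).
  rewrite (perm_big _ (permEl (perm_sort _ _))) big_cat /= -mulrA; congr (_ * _).
  by rewrite big_nseq iter_mulr_1 -exprMn mulN1r opprB.
have qs := He0 s; rewrite s0 (ltW st) /= in qs; have {}qs := qs isT.
have -> : p.[s] = q.[s] * \prod_(r <- rs) (s - r).
  rewrite pE hornerM horner_prod; congr (_ * _); apply: eq_bigr => r _.
  by rewrite hornerXsubC.
set P := \prod_(r <- rs) _; rewrite !mulrA pmulr_lge0; last first.
  by rewrite exprn_gt0// subr_gt0.
move=> H; rewrite (_ : _ * P = (e0 * q.[s]) * ((-1) ^+ (n - i) * P * (-1) ^+ (n - size rs))).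
  by rewrite mulr_ge0// ltW.
have sgB j : (j <= n)%N -> (-1) ^+ (n - j) = (-1) ^+ n * (-1) ^+ j :> R.
  by move=> jn; rewrite -{2}(subnK jn) exprD -mulrA -expr2 sqrr_sign mulr1.
rewrite !sgB// [RHS](_ : _ =
  e0 * (-1) ^+ size rs * (-1) ^+ i * q.[s] * P * ((-1) ^+ n) ^+ 2); last by ring.
by rewrite sqrr_sign mulr1; ring.
Qed.

(** * Integrals of continuous functions *)

Section RintContinuous.
Variable R : realType.
Implicit Types (a b : R) (f g : R -> R).
Local Notation mu := (@lebesgue_measure R).
Local Notation Rint := (@Defs.Rint R).

Lemma within_continuous_integrable a b f :
  {within `[a, b], continuous f} -> mu.-integrable `[a, b] (EFin \o f).
Proof. by move=> cf; apply: continuous_compact_integrable => //; exact: segment_compact. Qed.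

Lemma within_continuousM (A : set R) f g : {within A, continuous f} ->
  {within A, continuous g} -> {within A, continuous (fun s => f s * g s)}.
Proof. by move=> cf cg x; apply: (@continuousM R (subspace A)); [exact: cf|exact: cg]. Qed.

Lemma within_continuousD (A : set R) f g : {within A, continuous f} ->
  {within A, continuous g} -> {within A, continuous (fun s => f s + g s)}.
Proof. by move=> cf cg x; apply: (@continuousD R R (subspace A)); [exact: cf|exact: cg]. Qed.

Lemma within_continuousB (A : set R) f g : {within A, continuous f} ->
  {within A, continuous g} -> {within A, continuous (fun s => f s - g s)}.
Proof. by move=> cf cg x; apply: (@continuousB R R (subspace A)); [exact: cf|exact: cg]. Qed.

Lemma within_continuousZ (A : set R) (c : R) f : {within A, continuous f} ->
  {within A, continuous (fun s => c * f s)}.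
Proof. by move=> cf; apply: within_continuousM => // x; exact: cvg_cst. Qed.

Lemma within_continuous_norm (A : set R) f : {within A, continuous f} ->
  {within A, continuous (fun s => `|f s|)}.
Proof.
by move=> cf x; apply: cvg_norm; exact: cf.
Qed.

Lemma within_continuous_subitv a b c d f : c <= a -> b <= d ->
  {within `[c, d], continuous f} -> {within `[a, b], continuous f}.
Proof.
move=> ca bd; apply: continuous_subspaceW; apply: subset_itvScc => //.
Qed.

Lemma Rint_add a b f g : {within `[a, b], continuous f} -> {within `[a, b], continuous g} ->
  Rint a b (fun s => f s + g s) = Rint a b f + Rint a b g.
Proof. by move=> cf cg; apply: RintegralD => //; exact: within_continuous_integrable. Qed.

Lemma Rint_sub a b f g : {within `[a, b], continuous f} -> {within `[a, b], continuous g} ->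
  Rint a b (fun s => f s - g s) = Rint a b f - Rint a b g.
Proof. by move=> cf cg; apply: RintegralB => //; exact: within_continuous_integrable. Qed.

Lemma Rint_scale a b (c : R) f : {within `[a, b], continuous f} ->
  Rint a b (fun s => c * f s) = c * Rint a b f.
Proof. by move=> cf; apply: RintegralZl => //; exact: within_continuous_integrable. Qed.

Lemma eq_Rint a b f g : (forall s, a <= s <= b -> f s = g s) -> Rint a b f = Rint a b g.
Proof. by move=> fg; apply: eq_Rintegral => s /[!inE]/=; rewrite in_itv/=; exact: fg. Qed.

Lemma Rint_cst a b (c : R) : a <= b -> Rint a b (fun=> c) = c * (b - a).
Proof.
move=> ab; rewrite /Rint Rintegral_cst//= lebesgue_measure_itv /= lte_fin.
by case: ltP => //= ba; rewrite (_ : b = a) ?subrr//; apply/le_anti; rewrite ab ba.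
Qed.

Lemma Rint_degenerate a f : Rint a a f = 0.
Proof. by rewrite /Rint set_itv1 Rintegral_set1. Qed.

Lemma le_Rint a b f g : {within `[a, b], continuous f} -> {within `[a, b], continuous g} ->
  (forall s, a < s < b -> f s <= g s) -> Rint a b f <= Rint a b g.
Proof.
move=> cf cg fg; have [ba|ab] := leP b a.
  have [->|ba'] := eqVneq b a; first by rewrite !Rint_degenerate.
  rewrite /Rint set_itv_ge ?Rintegral_set0// bnd_simp -ltNge lt_neqAle ba' ba //.
have ioo h : {within `[a, b], continuous h} ->
    mu.-integrable `]a, b[ (EFin \o h) /\ mu.-integrable `[a, b[ (EFin \o h).
  move=> /within_continuous_integrable ih.
  by split; apply: integrableS ih => //; [exact: subset_itv_oo_cc|exact: subset_itv_co_cc].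
have [if1 if2] := ioo f cf; have [ig1 ig2] := ioo g cg.
have E h : mu.-integrable `]a, b[ (EFin \o h) -> mu.-integrable `[a, b[ (EFin \o h) ->
    Rint a b h = Rintegral mu `]a, b[ h.
  move=> i1 i2; rewrite /Rint -Rintegral_itv_bndo_bndc//.
  by rewrite -Rintegral_itv_obnd_cbnd.
by rewrite !E//; apply: le_Rintegral.
Qed.

Lemma norm_Rint_le a b f g : {within `[a, b], continuous f} ->
  {within `[a, b], continuous g} ->
  (forall s, a < s < b -> `|f s| <= g s) -> `|Rint a b f| <= Rint a b g.
Proof.
move=> cf cg fg; apply: (le_trans (le_normr_Rintegral _ _)) => //.
  exact: within_continuous_integrable.
by apply: le_Rint => //; exact: within_continuous_norm.
Qed.

Lemma Rint_cat a b c f : a <= b -> b <= c -> {within `[a, c], continuous f} ->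
  Rint a c f = Rint a b f + Rint b c f.
Proof.
move=> ab bc cf; have if_ := within_continuous_integrable cf.
apply/eqP; rewrite addrC -subr_eq; apply/eqP.
rewrite /Rint Rintegral_itvB ?bnd_simp//.
rewrite Rintegral_itv_obnd_cbnd//.
by apply: integrableS if_ => //; apply: subset_itvScc => //; rewrite bnd_simp.
Qed.

Lemma Rint_partition (f : R -> R) (tau : nat -> R) (k : nat) :
  (forall i, (i < k)%N -> tau i <= tau i.+1) ->
  {within `[tau 0, tau k], continuous f} ->
  \sum_(i < k) Rint (tau i) (tau i.+1) f = Rint (tau 0) (tau k) f.
Proof.
elim: k => [|k IH] tauS cf; first by rewrite big_ord0 Rint_degenerate.
have tau0k : tau 0%N <= tau k.
  elim: k {IH cf} tauS => // k IH tauS; apply: le_trans (IH _) (tauS k _) => //.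
  by move=> i ik; apply: tauS; rewrite ltnS ltnW.
rewrite big_ord_recr /= IH; last 2 first.
- by move=> i ik; apply: tauS; rewrite ltnS ltnW.
- by apply: within_continuous_subitv cf => //; exact: tauS.
by rewrite -Rint_cat//; exact: tauS.
Qed.

Lemma Rint_sum a b (k : nat) (F : nat -> R -> R) :
  (forall i, {within `[a, b], continuous (F i)}) ->
  {within `[a, b], continuous (fun s => \sum_(i < k) F i s)} /\
  Rint a b (fun s => \sum_(i < k) F i s) = \sum_(i < k) Rint a b (F i).
Proof.
move=> cF; elim: k => [|k [c IH]].
  have -> : (fun s => \sum_(i < 0) F i s) = (fun s : R => 0 : R).
    by apply/funext => s; rewrite big_ord0.
  split; first by move=> x; exact: cvg_cst.
  by rewrite big_ord0 /Rint Rintegral_cst// mul0r.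
have -> : (fun s => \sum_(i < k.+1) F i s) = (fun s => \sum_(i < k) F i s + F k s).
  by apply/funext => s; rewrite big_ord_recr.
split; first exact: within_continuousD.
by rewrite Rint_add// IH big_ord_recr.
Qed.

Lemma Rint_fundamental a b f F : a <= b -> {within `[a, b], continuous f} ->
  {within `[a, b], continuous F} ->
  (forall s, a < s < b -> is_derive s (1 : R) F (f s)) ->
  Rint a b f = F b - F a.
Proof.
rewrite le_eqVlt => /predU1P[->|ab] cf cF dF; first by rewrite Rint_degenerate subrr.
rewrite /Rint /Rintegral (@continuous_FTC2 R f F)//.
- have [_ Fa Fb] := (continuous_within_itvP _ ab).1 cF.
  split => // x; rewrite in_itv /= => /dF[] //.
- move=> x; rewrite in_itv /= => /dF dFx; rewrite derive1E.
  exact: derive_val.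
Qed.

Lemma exists_primitive a b f (c : R) : a < b -> {within `[a, b], continuous f} ->
  exists F, [/\ {within `[a, b], continuous F}, F a = c &
    forall s, a < s < b -> is_derive s (1 : R) F (f s)].
Proof.
move=> ab cf; have if_ := within_continuous_integrable cf.
exists (fun x => c + Rint a x f); split.
- apply: within_continuousD; first by move=> x; exact: cvg_cst.
  exact: (parameterized_integral_continuous (ltW ab) if_).
- by rewrite Rint_degenerate addr0.
move=> s /andP[as_ sb].
have [cfs _ _] := (continuous_within_itvP _ ab).1 cf.
have cs : {for s, continuous f} by apply: cfs; rewrite in_itv/= as_.
have [dF F's] := continuous_FTC1_closed sb if_ as_ cs.
rewrite -[f s]add0r; apply: is_deriveD.
by apply: DeriveDef => //; rewrite -derive1E.
Qed.

End RintContinuous.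

(** * Endpoints of integrator trajectories *)

Section IntegratorReachSet.
Variables (R : realType).
Local Notation Rint := (@Defs.Rint R).

Lemma is_derive_coord (m k : nat) (x : R -> 'M[R]_(m, k)) (s : R) (v : 'M[R]_(m, k)) :
  is_derive s (1 : R) x v <->
  forall i j, is_derive s (1 : R) (fun r => x r i j) (v i j).
Proof.
split=> [[dx xv] i j|H].
  have dx' := (derivable_mxP x s (1 : R)).1 dx i j.
  by apply: DeriveDef => //; rewrite -xv derive_mx// mxE.
have dx : derivable x s 1 by apply/derivable_mxP => i j; have [] := H i j.
apply: DeriveDef => //; rewrite derive_mx//; apply/matrixP => i j; rewrite mxE.
by have [] := H i j.
Qed.

Lemma within_continuous_coord (m k : nat) (A : set R) (x : R -> 'M[R]_(m, k)) :
  {within A, continuous x} <-> forall i j, {within A, continuous (fun r => x r i j)}.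
Proof.
split=> [cx i j r|H].
  by apply: (@continuous_comp (subspace A) _ _ x (fun M => M i j));
    [exact: cx|exact: coord_continuous].
apply/subspace_continuousP => r Ar; apply/cvg_ballP => e e0.
have : \forall r' \near within A (nbhs r), forall i j, ball (x r i j) e (x r' i j).
  apply: filter_forall => i; apply: filter_forall => j.
  by move/subspace_continuousP : (H i j) => /(_ r Ar) /cvg_ballP; exact.
by apply: filterS => r' Hr'; split.
Qed.

Lemma is_derive_taylor_coef (t s : R) (m : nat) :
  is_derive s (1 : R) (fun r : R => (t - r) ^+ m.+1 / (m.+1)`!%:R)
    (- ((t - s) ^+ m / m`!%:R)).
Proof.
have -> : (fun r : R => (t - r) ^+ m.+1 / (m.+1)`!%:R) =
    ((m.+1)`!%:R^-1 : R) \*: ((cst t - id) ^+ m.+1 : R -> R).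
  by apply/funext => r /=; rewrite exprfctE mulrC.
apply: is_derive_eq; rewrite sub0r /GRing.scale /= factS natrM invfM !fctE.
by field; rewrite addrC natr1 !pnatr_eq0 -lt0n fact_gt0.
Qed.

Lemma is_derive_taylor_sum (t s : R) (m : nat) (y : nat -> R -> R) (dy : R) :
  (forall j, (j < m)%N -> is_derive s (1 : R) (y j) (y j.+1 s)) ->
  is_derive s (1 : R) (y m) dy ->
  is_derive s (1 : R) (fun r => \sum_(j < m.+1) (t - r) ^+ j / j`!%:R * y j r)
    ((t - s) ^+ m / m`!%:R * dy).
Proof.
elim: m dy => [|m IH] dy yS ym.
  rewrite (_ : (fun r => _) = y 0); last first.
    by apply/funext => r; rewrite big_ord_recl big_ord0 addr0 expr0 divr1 mul1r.
  by rewrite expr0 divr1 mul1r.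
have -> : (fun r => \sum_(j < m.+2) (t - r) ^+ j / j`!%:R * y j r) =
    (fun r => \sum_(j < m.+1) (t - r) ^+ j / j`!%:R * y j r) +
    (fun r : R => (t - r) ^+ m.+1 / (m.+1)`!%:R) * y m.+1.
  by apply/funext => r; rewrite big_ord_recr.
have d1 := IH (y m.+1 s) (fun j jm => yS j (ltnW jm)) (yS m (ltnSn m)).
have d2 := is_derive_taylor_coef t s m.
apply: is_derive_eq.
rewrite /GRing.scale /=; ring.
Qed.

Lemma continuous_taylor_coef (t : R) (m : nat) :
  continuous (fun r : R => (t - r) ^+ m / m`!%:R).
Proof.
move=> s; apply: cvgM; last exact: cvg_cst.
apply: (@continuous_comp _ _ _ (fun r : R => t - r) (fun r => r ^+ m)).
  by apply: cvgB; [exact: cvg_cst|exact: cvg_id].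
exact: exprn_continuous.
Qed.

Lemma taylor_integral (t : R) (m : nat) (y : nat -> R -> R) (u : R -> R) : 0 < t ->
  (forall j, (j <= m)%N -> {within `[0, t], continuous (y j)}) ->
  {within `[0, t], continuous u} ->
  (forall j s, (j < m)%N -> 0 < s < t -> is_derive s (1 : R) (y j) (y j.+1 s)) ->
  (forall s, 0 < s < t -> is_derive s (1 : R) (y m) (u s)) ->
  y 0%N t = \sum_(j < m.+1) t ^+ j / j`!%:R * y j 0 +
    Rint 0 t (fun s => u s * ((t - s) ^+ m / m`!%:R)).
Proof.
move=> t0 cy cu dy du.
have cw k : {within `[0, t], continuous (fun r : R => (t - r) ^+ k / k`!%:R)}.
  by apply: continuous_subspaceT; exact: continuous_taylor_coef.
pose F r := \sum_(j < m.+1) (t - r) ^+ j / j`!%:R * y j r.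
have -> : Rint 0 t (fun s => u s * ((t - s) ^+ m / m`!%:R)) = F t - F 0.
  apply: Rint_fundamental.
  - exact: ltW.
  - exact: within_continuousM.
  - pose G j r := (t - r) ^+ j / j`!%:R * y (if (j <= m)%N then j else 0%N) r.
    have [|cG _] := @Rint_sum R 0 t m.+1 G.
      by move=> j; apply: within_continuousM => //; apply: cy; case: ifP.
    rewrite (_ : F = fun r => \sum_(j < m.+1) G j r)//.
    by apply/funext => r; apply: eq_bigr => j _; rewrite /G -ltnS ltn_ord.
  - move=> s s0t; rewrite mulrC; apply: is_derive_taylor_sum; last exact: du.
    by move=> j jm; apply: dy.
have -> : F 0 = \sum_(j < m.+1) t ^+ j / j`!%:R * y j 0.
  by apply: eq_bigr => j _; rewrite subr0.
rewrite addrC subrK /F big_ord_recl /= subrr expr0 divr1 mul1r big1 ?addr0//.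
by move=> i _; rewrite expr0n /= mul0r mul0r.
Qed.

Lemma chi_reindex (n : nat) (t : R) (x0 : 'cV[R]_n.+1) (k : 'I_n.+1) :
  chi t x0 k 0 = \sum_(j < (n - k).+1) t ^+ j / j`!%:R * x0 (inord (j + k)) 0.
Proof.
rewrite mxE (eq_bigr (fun l : 'I_n.+1 =>
  t ^+ (l - k) / (l - k)`!%:R * x0 (inord l) 0)); last first.
  by move=> l _; rewrite inord_val.
rewrite -(big_geq_mkord k n.+1 xpredT
  (fun l => t ^+ (l - k) / (l - k)`!%:R * x0 (inord l) 0)).
have := @big_addn R 0 +%R 0 n.+1 k xpredT
  (fun l => t ^+ (l - k) / (l - k)`!%:R * x0 (inord l) 0).
rewrite add0n subSn ?leq_ord// big_mkord => ->.
by apply: eq_bigr => j _; rewrite addnK.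
Qed.

Definition endpoint (n : nat) (t : R) (x0 : 'cV[R]_n.+1) (u : R -> R) : 'cV[R]_n.+1 :=
  chi t x0 + Rintv 0 t (fun s => u s *: xi n (t - s)).

Lemma Aint_bcon_coord (n : nat) (y : nat -> R) (u : R) (i : 'I_n.+1) :
  (Aint R n *m (\col_j y j) + u *: bcon R n) i 0 =
  if (i < n)%N then y i.+1 else u.
Proof.
rewrite !mxE; have [iN|iN] := ltnP i n.
  rewrite (bigD1 (inord i.+1))//= !mxE inordK ?ltnS// eqxx mul1r big1 ?addr0.
    by rewrite -val_eqE /= (ltn_eqF iN) mulr0 addr0.
  move=> j; case: (eqVneq (j : nat) i.+1) => [ji|ji _]; last by rewrite !mxE (negbTE ji) mul0r.
  by rewrite -val_eqE /= inordK ?ltnS// ji eqxx.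
have -> : i = ord_max by apply/val_inj/anti_leq; rewrite /= iN -ltnS ltn_ord.
rewrite eqxx mulr1 big1 ?add0r// => j _; rewrite !mxE ltn_eqF ?mul0r//=.
Qed.

Lemma trajectory_endpoint (n : nat) (t : R) (x0 : 'cV[R]_n.+1) (u : R -> R)
    (x : R -> 'cV[R]_n.+1) : 0 < t ->
  {within `[0, t], continuous u} -> {within `[0, t], continuous x} -> x 0 = x0 ->
  (forall s, 0 < s < t -> is_derive s (1 : R) x (Aint R n *m x s + u s *: bcon R n)) ->
  x t = endpoint t x0 u.
Proof.
move=> t0 cu cx x00 dx; apply/colP => k; rewrite mxE chi_reindex mxE.
pose y j s := x s (inord (j + k)) 0.
have xE s : x s = \col_(j < n.+1) x s (inord j) 0.
  by apply/colP => j; rewrite mxE inord_val.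
have dy s j : (j <= n - k)%N -> 0 < s < t ->
    is_derive s (1 : R) (y j) (if (j < n - k)%N then y j.+1 s else u s).
  move=> jk st; have := dx s st; rewrite xE => /is_derive_coord/(_ (inord (j + k)) 0).
  rewrite (Aint_bcon_coord (fun j => x s (inord j) 0)) inordK; last first.
    by rewrite ltnS addnC -leq_subRL ?leq_ord.
  by have -> : (j + k < n)%N = (j < n - k)%N by rewrite addnC ltn_subRL.
have -> : x t k 0 = y 0%N t by rewrite /y add0n inord_val.
apply: (eq_trans (@taylor_integral t (n - k) y u _ _ _ _ _)) => //; last first.
- congr (_ + _); first by apply: eq_bigr => j _; rewrite /y x00.
  by apply: eq_Rint => s _; rewrite !mxE.
- by move=> s st; have := dy s (n - k)%N (leqnn _) st; rewrite ltnn.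
- by move=> j s jk st; have := dy s j (ltnW jk) st; rewrite jk.
- by move=> j _; exact: ((within_continuous_coord _ _).1 cx (inord (j + k)) 0).
Qed.

Lemma exists_integrator_chain (t : R) (u : R -> R) (m : nat) (c : nat -> R) : 0 < t ->
  {within `[0, t], continuous u} ->
  exists y : nat -> R -> R, [/\ y m = u,
    forall i, (i <= m)%N -> {within `[0, t], continuous (y i)},
    forall i, (i < m)%N -> y i 0 = c i &
    forall i s, (i < m)%N -> 0 < s < t -> is_derive s (1 : R) (y i) (y i.+1 s)].
Proof.
move=> t0 cu; elim: m c => [|m IH] c; first by exists (fun=> u); split.
have [y [ym cy y0 dy]] := IH (fun i => c i.+1).
have [F [cF F0 dF]] := exists_primitive (c 0%N) t0 (cy 0%N isT).
exists (fun i => if i is j.+1 then y j else F); split => //.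
- by case.
- by case.
- by case=> [|i] s im st; [exact: dF|exact: dy].
Qed.

Lemma reach_setP (n : nat) (ulo uhi : R -> R) (t : R) (x0 y : 'cV[R]_n.+1) : 0 < t ->
  reach_set ulo uhi t x0 y <->
  exists u, [/\ {within `[0, t], continuous u},
    forall s, 0 <= s <= t -> ulo s <= u s <= uhi s & y = endpoint t x0 u].
Proof.
move=> t0; split=> [[u [x [cu bu [cx x00] dx ->]]]|[u [cu bu ->]]].
  by exists u; split => //; exact: trajectory_endpoint.
have [z [zm cz z0 dz]] := exists_integrator_chain n.+1 (fun i => x0 (inord i) 0) t0 cu.
pose x s : 'cV[R]_n.+1 := \col_i z i s.
have cx : {within `[0, t], continuous x}.
  apply/within_continuous_coord => i j.
  rewrite (_ : (fun r => _) = z i); last by apply/funext => r; rewrite mxE.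
  by apply: cz; rewrite ltnW.
have x00 : x 0 = x0 by apply/colP => i; rewrite mxE z0// inord_val.
have dx s : 0 < s < t -> is_derive s (1 : R) x (Aint R n *m x s + u s *: bcon R n).
  move=> st; apply/is_derive_coord => i j; rewrite (ord1 j).
  rewrite (Aint_bcon_coord (fun i => z i s)).
  rewrite (_ : (fun r => _) = z i); last by apply/funext => r; rewrite mxE.
  rewrite (_ : (if _ then _ else _) = z i.+1 s); first exact: dz.
  case: ltnP => // ni; rewrite -zm; congr (z _.+1 s).
  by apply/eqP; rewrite eqn_leq ni -ltnS ltn_ord.
exists u, x; split => //.
by rewrite (@trajectory_endpoint n t x0 u x).
Qed.

End IntegratorReachSet.

(** * Continuity of the input range *)

Section InputRangeContinuity.
Variable R : realType.
Local Notation Rint := (@Defs.Rint R).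

Lemma cvg_pseries_exp_bound (a : nat -> R) (D C x : R) :
  (forall k, `|a k| <= D * C ^+ k) -> cvgn (pseries (fun k => a k / k`!%:R) x).
Proof.
move=> aD; apply: normed_cvg.
have le k : `|a k / k`!%:R * x ^+ k| <= D * exp_coeff (C * `|x|) k.
  rewrite /exp_coeff /= exprMn !normrM normfV normr_nat normrX.
  rewrite mulrAC [leRHS]mulrA ler_wpM2r ?invr_ge0// mulrA ler_wpM2r// exprn_ge0//.
apply: (@series_le_cvg _ _ (D *: exp_coeff (C * `|x|))) => //.
- by move=> k; exact: normr_ge0.
- by move=> k; exact: (le_trans (normr_ge0 _) (le k)).
- exact/is_cvg_seriesZ/is_cvg_series_exp_coeff.
Qed.

Lemma continuous_pseries_exp_bound (a : nat -> R) (D C : R) :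
  (forall k, `|a k| <= D * C ^+ k) ->
  continuous (fun x => limn (pseries (fun k => a k / k`!%:R) x)).
Proof.
move=> aD x; apply/differentiable_continuous/derivable1_diffP.
have shift (b : nat -> R) : pseries_diffs (fun k => b k / k`!%:R) =
    fun k => b k.+1 / k`!%:R.
  apply/funext => k; rewrite /pseries_diffs factS natrM invfM mulrCA.
  by rewrite mulVKf// pnatr_eq0.
have cvg m y : cvgn (pseries (fun k => a (k + m)%N / k`!%:R) y).
  apply: (@cvg_pseries_exp_bound (fun k => a (k + m)%N) (D * C ^+ m) C) => k.
  by rewrite -mulrA -exprD addnC.
have c0 := cvg 0%N (`|x| + 1); have c1 := cvg 1%N (`|x| + 1).
have c2 := cvg 2%N (`|x| + 1).
have e0 : (fun k => a (k + 0)%N / k`!%:R) = (fun k => a k / k`!%:R).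
  by apply/funext => k; rewrite addn0.
have e1 : (fun k => a (k + 1)%N / k`!%:R) = pseries_diffs (fun k => a k / k`!%:R).
  by rewrite shift; apply/funext => k; rewrite addn1.
have e2 : (fun k => a (k + 2)%N / k`!%:R) =
    pseries_diffs (pseries_diffs (fun k => a k / k`!%:R)).
  by rewrite !shift; apply/funext => k; rewrite addn2.
rewrite e0 in c0; rewrite e1 in c1; rewrite e2 in c2.
have [|//] := pseries_snd_diffs c0 c1 c2 (x := x).
by rewrite [ltRHS]ger0_norm ?addr_ge0// ltrDl.
Qed.

Lemma mulmxX_entry_bound (n : nat) (A : 'M[R]_n.+1) :
  exists2 C : R, 0 <= C & forall k i j, `|(A ^+ k) i j| <= 1 * C ^+ k.
Proof.
pose B := \sum_i \sum_j `|A i j|.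
have B0 : 0 <= B by rewrite sumr_ge0// => i _; rewrite sumr_ge0.
have AB i j : `|A i j| <= B.
  rewrite /B (bigD1 i)//= (bigD1 j)//= -addrA lerDl addr_ge0//.
    by rewrite sumr_ge0.
  by rewrite sumr_ge0// => k _; rewrite sumr_ge0.
exists (n.+1%:R * B); first by rewrite mulr_ge0.
elim=> [|k IH] i j; first by rewrite !expr0 mulr1 mxE; case: eqP; rewrite ?normr1 ?normr0.
rewrite exprS mxE mul1r exprS; apply: (le_trans (ler_norm_sum _ _ _)).
apply: (@le_trans _ _ (\sum_(l < n.+1) B * (n.+1%:R * B) ^+ k)).
  by apply: ler_sum => l _; rewrite normrM ler_pM// -[leRHS]mul1r.
by rewrite sumr_const card_ord -[leLHS]mulr_natl mulrA.
Qed.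

Lemma continuous_expmx_entry (n : nat) (A : 'M[R]_n.+1) i j :
  continuous (fun r : R => expmx (r *: A) i j).
Proof.
have [C C0 HC] := mulmxX_entry_bound A.
rewrite (_ : (fun r => _) =
  fun r => limn (pseries (fun k => (A ^+ k) i j / k`!%:R) r)).
  by apply: continuous_pseries_exp_bound => k; exact: HC.
apply/funext => r; rewrite mxE /pseries; congr (limn (series _)).
by apply/funext => k; rewrite exprZn mxE -mulrA mulrC.
Qed.

Lemma continuous_sum (I : finType) (F : I -> R -> R) :
  (forall i, continuous (F i)) -> continuous (fun r => \sum_i F i r).
Proof. by move=> cF; apply: continuous_big => [|i _]; [exact: add_continuous|exact: cF]. Qed.

Lemma continuous_dotv_expmx (n : nat) (A : 'M[R]_n.+1) (c w : 'cV[R]_n.+1) :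
  continuous (fun r : R => dotv c (expmx (r *: A) *m w)).
Proof.
rewrite (_ : (fun r => _) =
  fun r => \sum_i (c i 0 * \sum_j (expmx (r *: A) i j * w j 0))); last first.
  apply/funext => r; rewrite /dotv mxE; apply: eq_bigr => i _.
  by rewrite !mxE.
apply: continuous_sum => i x; apply: cvgM; first exact: cvg_cst.
apply: (@continuous_sum _ (fun j r => expmx (r *: A) i j * w j 0)) => j y.
by apply: cvgM; [exact: continuous_expmx_entry|exact: cvg_cst].
Qed.

Lemma within_continuous_extend (a b : R) (f : R -> R) : a <= b ->
  {within `[a, b], continuous f} ->
  continuous (fun r => f (Num.max a (Num.min r b))).
Proof.
move=> ab /subspace_continuousP cf x.
pose h (r : R) := Num.max a (Num.min r b).
have hab r : `[a, b]%classic (h r).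
  by rewrite /= in_itv/= /h le_max lexx /= ge_max ab ge_min lexx orbT.
have ch : continuous h.
  move=> r; apply: (@continuous_max R _ (cst a) (fun r => Num.min r b)).
    exact: cvg_cst.
  by apply: (@continuous_min R _ id (cst b)); [exact: cvg_id|exact: cvg_cst].
apply: (@cvg_comp _ _ _ h f _ _ _ _ (cf (h x) (hab x))).
move=> U /= HU; have : nbhs x (fun r => `[a, b]%classic (h r) -> U (h r)) := ch x _ HU.
by apply: filterS => r; apply; exact: hab.
Qed.

Lemma Rint_reflect (s : R) (h : R -> R) : 0 <= s -> continuous h ->
  Rint 0 s (fun tau => h (s - tau)) = Rint 0 s h.
Proof.
rewrite le_eqVlt => /predU1P[<-|s0] ch; first by rewrite !Rint_degenerate.
have cs : continuous (fun tau : R => s - tau).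
  by move=> x; apply: cvgB; [exact: cvg_cst|exact: cvg_id].
have chs : {within `[0, s], continuous h} by exact: continuous_subspaceT.
have [H [cH H0 dH]] := exists_primitive 0 s0 chs.
rewrite (Rint_fundamental (ltW s0) chs cH dH).
have cH' := within_continuous_extend (ltW s0) cH.
have clampE r : 0 <= r <= s -> H (Num.max 0 (Num.min r s)) = H r.
  by move=> /andP[r0 rs]; rewrite min_l// max_r.
have -> : H s - H 0 = (fun tau => - H (s - tau)) s - (fun tau => - H (s - tau)) 0.
  by rewrite subrr subr0 opprK addrC.
apply: (@Rint_fundamental R 0 s (fun tau => h (s - tau)) (fun tau => - H (s - tau))).
- exact: ltW.
- apply: continuous_subspaceT => x.
  by apply: (@continuous_comp _ _ _ (fun tau : R => s - tau) h); [exact: cs|exact: ch].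
- apply: (@subspace_eq_continuous _ _ _
    (fun tau => - H (Num.max 0 (Num.min (s - tau) s)))).
    move=> r /[!inE] /=; rewrite in_itv/= => /andP[r0 rs]; rewrite clampE//.
    by rewrite subr_ge0 rs lerBlDr lerDl.
  apply: continuous_subspaceT => x; apply: cvgN.
  by apply: (@continuous_comp _ _ _ (fun tau : R => s - tau)
      (fun r => H (Num.max 0 (Num.min r s)))); [exact: cs|exact: cH'].
- move=> r /andP[r0 rs].
  have dHr : is_derive (s - r) (1 : R) H (h (s - r)).
    by apply: dH; rewrite subr_gt0 rs ltrBlDr ltrDl r0.
  have dsr : is_derive r (1 : R) (fun tau : R => s - tau) (-1).
    have -> : (fun tau : R => s - tau) = cst s - id by [].
    by apply: is_derive_eq; rewrite sub0r.
  have := @is_derive1_comp R H (fun tau : R => s - tau) r _ _ dHr dsr.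
  move=> /is_deriveN; rewrite mulrN1 opprK; exact.
Qed.

Section Extremum.
Variables (T : Type) (W : set T) (F : R -> T -> R) (t L B : R).
Hypothesis W0 : W !=set0.
Hypothesis FB : forall s w, 0 <= s <= t -> W w -> `|F s w| <= B.
Hypothesis FL : forall s s' w, 0 <= s <= t -> 0 <= s' <= t -> W w ->
  `|F s w - F s' w| <= L * `|s - s'|.

Lemma lipschitz_within_continuous (G : R -> R) :
  (forall s s', 0 <= s <= t -> 0 <= s' <= t -> G s <= G s' + L * `|s - s'|) ->
  {within `[0, t], continuous G}.
Proof.
move=> HG; apply/subspace_continuousP => s; rewrite /= in_itv/= => st.
apply/cvgrPdist_le => e e0.
have L1 : 0 < `|L| + 1 by rewrite ltr_wpDl.
rewrite near_withinE; near=> r; rewrite /= in_itv/= => rt.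
have rs : `|s - r| <= e / (`|L| + 1).
  by near: r; apply: (@cvgr_dist_le _ _ _ _ _ id s); rewrite ?divr_gt0//; exact: cvg_id.
have Le : L * `|s - r| <= e.
  apply: (@le_trans _ _ ((`|L| + 1) * `|s - r|)).
    by rewrite ler_wpM2r// (le_trans (ler_norm _))// lerDl.
  by rewrite mulrC -ler_pdivlMr.
have H1 := HG s r st rt; have H2 := HG r s rt st.
rewrite (distrC r s) in H2.
rewrite ler_distl lerBlDr (le_trans H2) ?lerD2l//=.
by rewrite (le_trans H1) ?lerD2l.
Unshelve. all: by end_near. Qed.

Lemma continuous_sup_image : {within `[0, t], continuous (fun s => sup (F s @` W))}.
Proof.
apply: lipschitz_within_continuous => s s' st s't.
apply: ge_sup; first by have [w Ww] := W0; exists (F s w), w.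
move=> _ [w Ww <-]; have := FL st s't Ww; rewrite ler_norml => /andP[_ H].
have : F s' w <= sup (F s' @` W).
  apply: sup_ubound; last by exists w.
  exists B => _ [w' Ww' <-]; exact: le_trans (ler_norm _) (FB s't Ww').
lra.
Qed.

Lemma continuous_inf_image : {within `[0, t], continuous (fun s => inf (F s @` W))}.
Proof.
apply: lipschitz_within_continuous => s s' st s't.
rewrite -lerBlDr; apply: lb_le_inf; first by have [w Ww] := W0; exists (F s' w), w.
move=> _ [w Ww <-]; have := FL st s't Ww; rewrite ler_norml => /andP[_ H].
have : inf (F s @` W) <= F s w.
  apply: inf_lbound; last by exists w.
  exists (- B) => _ [w' Ww' <-]; have := FB st Ww'; rewrite ler_norml => /andP[]//.
lra.
Qed.

End Extremum.

Lemma within_continuous_bounded (a b : R) (f : R -> R) :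
  {within `[a, b], continuous f} ->
  exists2 K : R, 0 <= K & forall s, a <= s <= b -> `|f s| <= K.
Proof.
move=> cf; have /compact_bounded[M [_ HM]] :=
  continuous_compact cf (@segment_compact _ a b).
exists (`|M| + 1); first by rewrite addr_ge0.
move=> s sab; apply: (HM (`|M| + 1)); first by rewrite ltr_pwDr// ler_norm.
by exists s => //=; rewrite in_itv.
Qed.

Section InputRange.
Variables (n : nat) (A : 'M[R]_n.+1) (vmin vmax t : R).
Hypothesis vv : vmin <= vmax.

Let W : set (R -> R) :=
  [set w | continuous w /\ forall r, vmin <= w r <= vmax].
Let g (r : R) : R := dotv (ccoef A) (expmx (r *: Acon A) *m bcon R n).
Let J (s : R) (w : R -> R) : R := w 0 - Rint 0 s (fun r => g r * w r).

Let cg : continuous g. Proof. exact: continuous_dotv_expmx. Qed.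

Let cgw w : W w -> continuous (fun r => g r * w r).
Proof. by move=> [cw _] x; apply: cvgM; [exact: cg|exact: cw]. Qed.

(* Reversing time, [v tau = w (s - tau)], moves the dependence on [s] from the
   kernel to the upper bound of the integral. *)
Lemma Iset_reflect (s : R) : 0 <= s -> Iset A vmin vmax s = J s @` W.
Proof.
move=> s0; apply/seteqP; split=> [_ [v [cv bv] <-]|_ [w Ww <-]].
- pose w r := v (s - Num.max 0 (Num.min r s)).
  have s_ (r : R) : 0 <= s - Num.max 0 (Num.min r s) <= s.
    rewrite subr_ge0 ge_max s0 ge_min lexx orbT /= lerBlDr lerDl.
    by rewrite le_max lexx.
  have Ww : W w.
    split; last by move=> r; apply: bv.
    have cv' := within_continuous_extend s0 cv.
    have -> : w = fun r => v (Num.max 0 (Num.min (s - Num.max 0 (Num.min r s)) s)).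
      apply/funext => r; have /andP[h1 h2] := s_ r.
      by rewrite [in RHS]min_l// [in RHS]max_r.
    move=> x; apply: (@continuous_comp _ _ _ (fun r => s - Num.max 0 (Num.min r s))
      (fun r => v (Num.max 0 (Num.min r s)))); last exact: cv'.
    apply: cvgB; first exact: cvg_cst.
    apply: (@continuous_max R _ (cst 0) (fun r => Num.min r s)); first exact: cvg_cst.
    by apply: (@continuous_min R _ id (cst s)); [exact: cvg_id|exact: cvg_cst].
  exists w => //; rewrite /J /Ifun -(Rint_reflect s0 (cgw Ww)).
  congr (_ - _); first by rewrite /w min_l// max_l// subr0.
  apply: eq_Rint => r /andP[r0 rs]; congr (_ * _).
  by rewrite /w min_l ?max_r ?subr_ge0// ?lerBlDr ?lerDl// opprB addrC subrK.
- exists (fun tau => w (s - tau)).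
    have [cw bw] := Ww; split; last by move=> *; exact: bw.
    apply: continuous_subspaceT => x.
    apply: (@continuous_comp _ _ _ (fun tau : R => s - tau) w); last exact: cw.
    by apply: cvgB; [exact: cvg_cst|exact: cvg_id].
  by rewrite /J /Ifun subrr -(Rint_reflect s0 (cgw Ww)).
Qed.

Let V := `|vmin| + `|vmax|.

Let Wnorm w r : W w -> `|w r| <= V.
Proof.
move=> [_ /(_ r)/andP[h1 h2]]; rewrite /V ler_norml.
have := ler_norm vmax; have := ler_norm (- vmin); rewrite normrN.
have := normr_ge0 vmin; have := normr_ge0 vmax; lra.
Qed.

Let Jlip : exists L : R, forall s s' w, 0 <= s <= t -> 0 <= s' <= t -> W w ->
  `|J s w - J s' w| <= L * `|s - s'|.
Proof.
have cgt : {within `[0, t], continuous g} by exact: continuous_subspaceT.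
have [G G0 HG] := within_continuous_bounded cgt.
exists (G * V) => s s' w; wlog ss' : s s' / s <= s'.
  move=> H st s't Ww; have /orP[ss|ss] := le_total s s'; first exact: H.
  by rewrite distrC [X in _ * X]distrC; exact: H.
move=> /andP[s0 st] /andP[s'0 s't] Ww.
have cw a b : {within `[a, b], continuous (fun r => g r * w r)}.
  exact/continuous_subspaceT/cgw.
rewrite /J (Rint_cat s0 ss' (cw 0 s')).
rewrite (_ : _ - _ - _ = Rint s s' (fun r => g r * w r)); last by ring.
apply: (le_trans (@norm_Rint_le R s s' _ (fun=> G * V) (cw s s') _ _)).
- by move=> x; exact: cvg_cst.
- move=> r /andP[sr rs]; rewrite normrM ler_pM// ?Wnorm// HG//.
  by apply/andP; split; [exact: le_trans s0 (ltW sr)|exact: le_trans (ltW rs) s't].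
- by rewrite Rint_cst// distrC ger0_norm// subr_ge0.
Qed.

Let Jbound : exists B : R, forall s w, 0 <= s <= t -> W w -> `|J s w| <= B.
Proof.
have [L HL] := Jlip.
exists (V + `|L| * t) => s w /andP[s0 st] Ww.
have t0 : 0 <= t by exact: le_trans st.
have := HL s 0 w; rewrite s0 st lexx t0 => /(_ isT isT Ww).
have -> : J 0 w = w 0 by rewrite /J Rint_degenerate subr0.
rewrite subr0 (ger0_norm s0) => H.
have -> : J s w = w 0 + (J s w - w 0) by rewrite addrC subrK.
apply: (le_trans (ler_normD _ _)); apply: lerD; first exact: Wnorm.
apply: (le_trans H); apply: (@le_trans _ _ (`|L| * s)).
  by rewrite ler_wpM2r// ler_norm.
by rewrite ler_wpM2l.
Qed.

Let W0 : W !=set0.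
Proof. by exists (fun=> vmin); split=> [x|r]; [exact: cvg_cst|rewrite lexx]. Qed.

Lemma continuous_Imin : {within `[0, t], continuous (Imin A vmin vmax)}.
Proof.
have [L HL] := Jlip; have [B HB] := Jbound.
apply: (@subspace_eq_continuous _ _ _ (fun s => inf (J s @` W))); last first.
  exact: (continuous_inf_image W0 HB HL).
move=> s /[!inE]/=; rewrite in_itv/= => /andP[s0 _].
exact: (congr1 inf (esym (Iset_reflect s0))).
Qed.

Lemma continuous_Imax : {within `[0, t], continuous (Imax A vmin vmax)}.
Proof.
have [L HL] := Jlip; have [B HB] := Jbound.
apply: (@subspace_eq_continuous _ _ _ (fun s => sup (J s @` W))); last first.
  exact: (continuous_sup_image W0 HB HL).
move=> s /[!inE]/=; rewrite in_itv/= => /andP[s0 _].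
exact: (congr1 sup (esym (Iset_reflect s0))).
Qed.

Variables (b z0 : 'cV[R]_n.+1).

Lemma continuous_umin : {within `[0, t], continuous (umin A b vmin vmax z0)}.
Proof.
apply: within_continuousD; last exact: continuous_Imin.
by apply: continuous_subspaceT => x; apply: cvgN; exact: continuous_dotv_expmx.
Qed.

Lemma continuous_umax : {within `[0, t], continuous (umax A b vmin vmax z0)}.
Proof.
apply: within_continuousD; last exact: continuous_Imax.
by apply: continuous_subspaceT => x; apply: cvgN; exact: continuous_dotv_expmx.
Qed.

End InputRange.
End InputRangeContinuity.

Lemma Rint_resolvent_small (R : realType) (t : R) (p : {poly R}) (e : R) : p != 0 ->
  0 < e -> exists2 d : R, 0 < d & @Defs.Rint R 0 t (fun s => d / (`|p.[s]| + d)) <= e.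
Proof.
move=> p0 e0.
pose d (k : nat) : R := harmonic k.
have d0 k : 0 < d k by rewrite /d /harmonic /= invr_gt0 ltr0Sn.
have den0 k s : 0 < `|p.[s]| + d k by rewrite ltr_wpDl.
pose f k s := d k / (`|p.[s]| + d k).
have cf k : {within `[0, t], continuous (f k)}.
  apply: continuous_subspaceT => s; apply: cvgM; first exact: cvg_cst.
  apply: cvgV; first by rewrite gt_eqF.
  apply: cvgD; last exact: cvg_cst.
  by apply: cvg_norm; exact: continuous_horner.
have [rs [q [pE _ _ q0]]] := @poly_split_roots_itv R 0 t (size p).-1 p p0 (leqSpred _).
have mf k := measurable_int (@lebesgue_measure R) (within_continuous_integrable (cf k)).
have f0 : {ae (@lebesgue_measure R),
    forall s, `[0, t]%classic s -> (f k s)%:E @[k --> \oo] --> 0%E}.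
  have crs : countable [set` rs] by exact/finite_set_countable/finite_seq.
  exists [set` rs]; split.
  - exact: countable_measurable.
  - exact: countable_lebesgue_measure0.
  move=> s; apply: contra_notP => /= srs; rewrite in_itv/= => st.
  have ps : `|p.[s]| != 0.
    rewrite normr_eq0 pE hornerM mulf_neq0 ?q0// horner_prod.
    rewrite prodf_seq_neq0; apply/allP => r rrs /=.
    by rewrite hornerXsubC subr_eq0; apply: contra_notN srs => /eqP ->.
  apply: cvg_EFin; first exact: nearW.
  have -> : (0 : R) = 0 / (`|p.[s]| + 0) by rewrite mul0r.
  apply: cvgM; first exact: cvg_harmonic.
  apply: cvgV; first by rewrite addr0.
  by apply: cvgD; [exact: cvg_cst|exact: cvg_harmonic].
have c1 : {within `[0, t], continuous (cst 1 : R -> R)} by move=> x; exact: cvg_cst.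
have c0 : {within `[0, t], continuous (cst 0 : R -> R)} by move=> x; exact: cvg_cst.
have m0 := measurable_int (@lebesgue_measure R) (within_continuous_integrable c0).
have i1 := within_continuous_integrable c1.
have f1 : {ae (@lebesgue_measure R),
    forall s k, `[0, t]%classic s -> (`|(f k s)%:E| <= 1%R%:E)%E}.
  apply: aeW => s k st /=; rewrite lee_fin ger0_norm; last first.
    by rewrite divr_ge0// ltW.
  by rewrite ler_pdivrMr// mul1r lerDr.
have DC := @dominated_convergence _ _ R (@lebesgue_measure R) _
  (measurable_itv `[0, t]) _ _ (EFin \o cst 1) mf m0.
have [_ _] := DC f0 i1 f1.
rewrite integral0 => /fine_cvgP[_ /cvgrPdist_le /(_ e e0)].
move=> [N _ /(_ N (leqnn N))] /=; rewrite sub0r normrN => H.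
by exists (d N) => //; apply: le_trans H; exact: ler_norm.
Qed.

Lemma sigext_nth (R : realType) (n : nat) (t : R) (l : seq R) (i : nat) : size l = n ->
  sigext t (fun k : 'I_n => nth t l k) i = nth t (0 :: rcons l t) i.
Proof.
move=> sl; case: i => // j; rewrite /sigext /= nth_rcons sl.
case: insubP => [k /= kn <-|]; first by rewrite ltn_ord.
by move=> /negbTE ->; case: ifP.
Qed.

Lemma poly_switching_times (R : realType) (t : R) (n : nat) (p : {poly R}) :
  0 <= t -> p != 0 -> (size p <= n.+1)%N ->
  exists (sg : 'I_n -> R) (e : R), [/\ weyl t sg, e = 1 \/ e = -1,
    forall i, (i < n.+1)%N -> sigext t sg i <= sigext t sg i.+1,
    sigext t sg n.+1 = t &
    forall (i : 'I_n.+1) s, sigext t sg i < s < sigext t sg i.+1 ->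
      0 <= e * (-1) ^+ i * p.[s]].
Proof.
move=> t0 p0 sp; have [l [e [sl lsort lt e1 Hp]]] := poly_sign_pattern t0 p0 sp.
pose L := 0 :: rcons l t.
have sL : size L = n.+2 by rewrite /= size_rcons sl.
have sortL : sorted <=%R L.
  rewrite /L /= rcons_path path_min_sorted ?lsort /=; last first.
    by apply/allP => r /lt/andP[].
  by case: l lt {sl lsort Hp L sL} => //= r l lt; have /andP[] := lt _ (mem_last r l).
have mono i j : (i <= j)%N -> (j <= n.+1)%N -> nth t L i <= nth t L j.
  move=> ij jn; apply: (le_sorted_leq_nth t sortL) => //; rewrite inE sL ltnS//.
  exact: leq_trans jn.
pose sg (k : 'I_n) := nth t l k.
have sgE i : sigext t sg i = nth t L i by exact: sigext_nth.
have lL j : (j < n)%N -> nth t l j = nth t L j.+1.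
  by move=> jn; rewrite /L /= nth_rcons sl jn.
exists sg, e; split => //.
- split=> [i|i j ij]; first by apply: lt; rewrite mem_nth// sl.
  by rewrite /sg !lL//; apply: mono; rewrite ?ltnS//; exact: ltnW.
- by move=> i iN; rewrite !sgE; apply: mono.
- by rewrite sgE /= nth_rcons sl ltnn eqxx.
move=> i s; rewrite !sgE => /andP[is_ si].
have i_n : (i <= n)%N by rewrite -ltnS.
apply: Hp => //.
- apply/andP; split.
    by apply: ltW; apply: le_lt_trans is_; exact: (mono 0%N i isT (leqW i_n)).
  apply: (lt_le_trans si); rewrite -[leRHS](_ : nth t L n.+1 = t); first exact: mono.
  by rewrite /L /= nth_rcons sl ltnn eqxx.
- move=> r /(nthP t)[j]; rewrite size_take_min leq_min => /andP[ji _] <-.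
  rewrite nth_take// lL; last exact: leq_trans ji i_n.
  by apply: ltW; apply: le_lt_trans is_; apply: mono => //; exact: ltnW.
- move=> r /(nthP t)[j]; rewrite size_drop sl => jm <-.
  have ijn : (i + j < n)%N by rewrite -ltn_subRL.
  rewrite nth_drop lL//; apply: ltW; apply: (lt_le_trans si); apply: mono.
    by rewrite ltnS leq_addr.
  exact: leqW.
Qed.

(** * Bang-bang points *)

Section BangBang.
Variables (R : realType) (n : nat) (t : R) (ulo uhi : R -> R) (x0 : 'cV[R]_n.+1).
Local Notation Rint := (@Defs.Rint R).
Hypothesis t0 : 0 < t.
Hypothesis culo : {within `[0, t], continuous ulo}.
Hypothesis cuhi : {within `[0, t], continuous uhi}.

Let mu s := (uhi s - ulo s) / 2.
Let nu s := (uhi s + ulo s) / 2.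

Let cmu : {within `[0, t], continuous mu}.
Proof.
by apply: within_continuousM; [exact: within_continuousB|move=> x; exact: cvg_cst].
Qed.

Let cnu : {within `[0, t], continuous nu}.
Proof.
by apply: within_continuousM; [exact: within_continuousD|move=> x; exact: cvg_cst].
Qed.

Let adm (u : R -> R) := {within `[0, t], continuous u} /\
  forall s, 0 <= s <= t -> ulo s <= u s <= uhi s.

Variables (sg : 'I_n -> R) (eps : R).
Hypothesis eps1 : eps = 1 \/ eps = -1.
Local Notation tau := (sigext t sg).
Hypothesis tauS : forall i, (i < n.+1)%N -> tau i <= tau i.+1.
Hypothesis tauN : tau n.+1 = t.

Let e (i : nat) : R := eps * (-1) ^+ i.

Let e1 i : e i = 1 \/ e i = -1.
Proof.
rewrite /e -signr_odd; case: odd; case: eps1 => ->;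
  rewrite ?expr0 ?expr1 ?mulr1 ?mulrN1 ?opprK; auto.
Qed.

Let mono_tau i j : (i <= j)%N -> (j <= n.+1)%N -> tau i <= tau j.
Proof.
elim: j => [|j IH]; first by rewrite leqn0 => /eqP ->.
rewrite leq_eqVlt => /predU1P[->//|ij] jn.
by apply: le_trans (IH ij (ltnW jn)) (tauS jn).
Qed.

Let tau_bounds (i : 'I_n.+1) : 0 <= tau i /\ tau i.+1 <= t.
Proof.
have h1 := @mono_tau 0%N i isT (ltnW (ltn_ord i)).
have h2 := @mono_tau i.+1 n.+1 (ltn_ord i) (leqnn _).
by split => //; rewrite -[leRHS]tauN.
Qed.

Let cseg (i : 'I_n.+1) (f : R -> R) : {within `[0, t], continuous f} ->
  {within `[tau i, tau i.+1], continuous f}.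
Proof.
by have [h1 h2] := tau_bounds i; exact: within_continuous_subitv.
Qed.

Let in_seg (i : 'I_n.+1) s : tau i < s < tau i.+1 -> 0 <= s <= t.
Proof.
move=> /andP[/ltW h1 /ltW h2]; have [h3 h4] := tau_bounds i.
by rewrite (le_trans h3 h1) (le_trans h2 h4).
Qed.

Let partition (f : R -> R) : {within `[0, t], continuous f} ->
  \sum_(i < n.+1) Rint (tau i) (tau i.+1) f = Rint 0 t f.
Proof. by move=> cf; have := @Rint_partition R f tau n.+1 tauS; rewrite tauN; exact. Qed.

(* The moment against [w] of the bang-bang input minus that of [u], written on the
   segments where the bang-bang input is continuous. *)
Let dev (u w : R -> R) : R :=
  \sum_(i < n.+1) Rint (tau i) (tau i.+1) (fun s => (nu s + e i * mu s - u s) * w s).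

Let cdiff (i : nat) (u : R -> R) : {within `[0, t], continuous u} ->
  {within `[0, t], continuous (fun s => nu s + e i * mu s - u s)}.
Proof.
move=> cu; apply: within_continuousB => //; apply: within_continuousD => //.
exact: within_continuousZ.
Qed.

Let devE (u w : R -> R) : {within `[0, t], continuous u} -> {within `[0, t], continuous w} ->
  dev u w = Rint 0 t (fun s => nu s * w s) +
    eps * \sum_(i < n.+1) (-1) ^+ i * Rint (tau i) (tau i.+1) (fun s => mu s * w s) -
    Rint 0 t (fun s => u s * w s).
Proof.
move=> cu cw.
have cnw := within_continuousM cnu cw; have cmw := within_continuousM cmu cw.
have cuw := within_continuousM cu cw.
rewrite -(partition cnw) -(partition cuw) mulr_sumr -big_split -sumrB /=.
apply: eq_bigr => i _; rewrite mulrA -/(e i).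
rewrite -(Rint_scale (e i) (@cseg i _ cmw)) -Rint_add; [|exact: cseg|]; last first.
  by apply: cseg; exact: within_continuousZ.
rewrite -Rint_sub; last 2 first.
- by apply: cseg; apply: within_continuousD => //; exact: within_continuousZ.
- exact: cseg.
by apply: eq_Rint => s _; ring.
Qed.

Let dev_sum (u : R -> R) (c : nat -> R) (w : nat -> R -> R) (m : nat) :
  {within `[0, t], continuous u} -> (forall j, {within `[0, t], continuous (w j)}) ->
  dev u (fun s => \sum_(j < m) c j * w j s) = \sum_(j < m) c j * dev u (w j).
Proof.
move=> cu cw; rewrite /dev.
under [RHS]eq_bigr do rewrite mulr_sumr.
rewrite exchange_big /=; apply: eq_bigr => i _.
pose F j s := c j * ((nu s + e i * mu s - u s) * w j s).
have cF j : {within `[tau i, tau i.+1], continuous (F j)}.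
  apply: cseg; apply: within_continuousZ; apply: within_continuousM => //.
  exact: cdiff.
have [_ FE] := Rint_sum m cF.
transitivity (Rint (tau i) (tau i.+1) (fun s => \sum_(j < m) F j s)).
  by apply: eq_Rint => s _; rewrite mulr_sumr; apply: eq_bigr => j _; rewrite /F; ring.
rewrite FE; apply: eq_bigr => j _; rewrite Rint_scale//.
by apply: cseg; apply: within_continuousM => //; exact: cdiff.
Qed.

Variable p : {poly R}.
Hypothesis p_sign : forall (i : 'I_n.+1) s, tau i < s < tau i.+1 -> 0 <= e i * p.[s].

Let cp : {within `[0, t], continuous (fun s => p.[s])}.
Proof. by apply: continuous_subspaceT; exact: continuous_horner. Qed.

Let cres d : 0 < d -> {within `[0, t], continuous (fun s => d / (`|p.[s]| + d))}.
Proof.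
move=> d0; apply: continuous_subspaceT => s; apply: cvgM; first exact: cvg_cst.
apply: cvgV; first by rewrite gt_eqF// ltr_wpDl.
by apply: cvgD; [apply: cvg_norm; exact: continuous_horner|exact: cvg_cst].
Qed.

Let seg_signs (u : R -> R) (i : 'I_n.+1) s : adm u -> tau i < s < tau i.+1 ->
  let a := nu s + e i * mu s - u s in
  [/\ `|a| <= uhi s - ulo s, a * p.[s] = `|a| * `|p.[s]| & e i * p.[s] = `|p.[s]|].
Proof.
move=> [_ bu] sseg a; have /andP[h1 h2] := bu s (in_seg sseg).
have := p_sign sseg; rewrite /a /nu /mu; case: (e1 i) => ->.
  rewrite !mul1r => ps; rewrite (_ : _ - u s = uhi s - u s); last by field.
  by rewrite (ger0_norm ps) ger0_norm ?subr_ge0// lerD2l lerN2.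
rewrite !mulN1r oppr_ge0 => ps; rewrite (_ : _ - u s = ulo s - u s); last by field.
by rewrite (ler0_norm ps) ler0_norm ?subr_le0// mulrNN opprB lerD2r.
Qed.

(* With [a = |u* - u|], [a <= a |p| / d + a d / (|p| + d)] pointwise. *)
Lemma dev_norm_le (u w : R -> R) (K M d : R) : adm u -> {within `[0, t], continuous w} ->
  0 < d -> 0 <= K ->
  (forall s, 0 <= s <= t -> `|w s| <= K) ->
  (forall s, 0 <= s <= t -> uhi s - ulo s <= M) ->
  `|dev u w| <= K * (d^-1 * dev u (fun s => p.[s]) +
    M * Rint 0 t (fun s => d / (`|p.[s]| + d))).
Proof.
move=> au cw d0 K0 wK uM; have [cu bu] := au.
rewrite -(partition (cres d0)) /dev !mulr_sumr -big_split mulr_sumr.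
apply: (le_trans (ler_norm_sum _ _ _)); apply: ler_sum => i _ /=.
have ci := @cdiff i u cu; have cip := within_continuousM ci cp.
have cip' := @within_continuousZ R _ d^-1 _ cip.
have cr' := @within_continuousZ R _ M _ (cres d0).
rewrite -(Rint_scale _ (@cseg i _ cip)) -(Rint_scale _ (@cseg i _ (cres d0))).
rewrite -Rint_add; [|exact: cseg|exact: cseg].
rewrite -Rint_scale; last by apply: cseg; exact: within_continuousD.
apply: norm_Rint_le.
- by apply: cseg; exact: within_continuousM.
- by apply: cseg; apply: within_continuousZ; exact: within_continuousD.
move=> s sseg; have st := in_seg sseg.
have [] := seg_signs au sseg; set a := _ - u s => aM ap _.
rewrite normrM mulrC ap; apply: ler_pM => //; first exact: wK.
have P0 : 0 < `|p.[s]| + d by rewrite ltr_wpDl.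
have := le_trans aM (uM s st); set P := `|p.[s]| in P0 *.
have : 0 <= P by exact: normr_ge0.
have := normr_ge0 a; set b := `|a| => b0 P1 bM.
apply: (@le_trans _ _ (d^-1 * (b * P) + b * (d / (P + d)))); last first.
  by rewrite lerD2l ler_wpM2r// divr_ge0 ?ltW.
have -> : d^-1 * (b * P) + b * (d / (P + d)) = b + b * (P ^+ 2 / (d * (P + d))).
  by field; rewrite !gt_eqF.
by rewrite lerDl mulr_ge0// divr_ge0 ?sqr_ge0// mulr_ge0// ltW.
Qed.

Definition soft_bang (d s : R) := nu s + mu s * (p.[s] / (`|p.[s]| + d)).

Lemma adm_soft_bang d : 0 < d ->
  (forall s, 0 <= s <= t -> ulo s <= uhi s) -> adm (soft_bang d).
Proof.
move=> d0 lohi; split.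
  apply: within_continuousD => //; apply: within_continuousM => //.
  apply: continuous_subspaceT => s; apply: cvgM; first exact: continuous_horner.
  apply: cvgV; first by rewrite gt_eqF// ltr_wpDl.
  by apply: cvgD; [apply: cvg_norm; exact: continuous_horner|exact: cvg_cst].
move=> s st; have P0 : 0 < `|p.[s]| + d by rewrite ltr_wpDl.
rewrite /soft_bang; set q := p.[s] / _; have : `|q| <= 1.
  by rewrite normrM normfV (gtr0_norm P0) ler_pdivrMr// mul1r lerDl ltW.
rewrite ler_norml => /andP[q1 q2]; have := lohi s st.
rewrite /nu /mu => ?.
have : 0 <= uhi s - ulo s by rewrite subr_ge0.
by move=> ?; apply/andP; split; nra.
Qed.

Lemma dev_soft_bang_le (d M : R) : 0 < d ->
  (forall s, 0 <= s <= t -> ulo s <= uhi s) ->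
  (forall s, 0 <= s <= t -> uhi s - ulo s <= M) ->
  dev (soft_bang d) (fun s => p.[s]) <= M * d * t.
Proof.
move=> d0 lohi uM; have au := adm_soft_bang d0 lohi; have [cu bu] := au.
have cM : {within `[0, t], continuous (fun _ : R => M * d)} by move=> x; exact: cvg_cst.
have -> : M * d * t = Rint 0 t (fun=> M * d) by rewrite Rint_cst ?subr0// ltW.
rewrite -(partition cM).
apply: ler_sum => i _; apply: le_Rint.
- by apply: cseg; apply: within_continuousM => //; exact: cdiff.
- exact: cseg.
move=> s sseg; have st := in_seg sseg.
have [_ _ ep] := seg_signs au sseg.
have P0 : 0 < `|p.[s]| + d by rewrite ltr_wpDl.
have m0 : 0 <= mu s by rewrite /mu divr_ge0// subr_ge0 lohi.
have mM : mu s <= M.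
  have h1 := uM s st; have h2 := lohi s st; rewrite /mu.
  by rewrite ler_pdivrMr//; lra.
rewrite /soft_bang (_ : _ * _ = mu s * (`|p.[s]| * d / (`|p.[s]| + d))); last first.
  rewrite (_ : (_ + _ - _) * _ = mu s * (e i * p.[s] - p.[s] ^+ 2 / (`|p.[s]| + d)));
    last by ring.
  rewrite ep -(real_normK (num_real p.[s])); congr (_ * _).
  by field; rewrite gt_eqF.
apply: ler_pM => //; first by rewrite divr_ge0 ?mulr_ge0// ltW.
by rewrite ler_pdivrMr// mulrC ler_pM2l// lerDl ltW.
Qed.

Let bang_point : 'cV[R]_n.+1 :=
  chi t x0 + Rintv 0 t (fun s => nu s *: xi n (t - s))
  + eps *: \sum_(i < n.+1)
      ((-1) ^+ i *: Rintv (tau i) (tau i.+1) (fun s => mu s *: xi n (t - s))).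

Let w (j : 'I_n.+1) (s : R) : R := xi n (t - s) j 0.

Let cw j : {within `[0, t], continuous (w j)}.
Proof.
apply: continuous_subspaceT; rewrite (_ : w j = fun r => (t - r) ^+ (n - j) / (n - j)`!%:R).
  exact: continuous_taylor_coef.
by apply/funext => s; rewrite /w mxE.
Qed.

Let bang_point_dev (u : R -> R) (j : 'I_n.+1) : {within `[0, t], continuous u} ->
  bang_point j 0 - endpoint t x0 u j 0 = dev u (w j).
Proof.
move=> cu; rewrite devE// /bang_point /endpoint !mxE summxE.
have RE a b f : Rint a b (fun s => (f s *: xi n (t - s)) j 0) =
    Rint a b (fun s => f s * w j s).
  by apply: eq_Rint => s _; rewrite mxE.
rewrite !RE; set c := \sum_(l < n.+1 | (j <= l)%N) _.
under eq_bigr do rewrite !mxE RE.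
ring.
Qed.

Lemma boundary_is_bang_point (eta : 'I_n.+1 -> R) (xb : 'cV[R]_n.+1) : p != 0 ->
  (forall s, p.[s] = \sum_j eta j * w j s) ->
  closure (reach_set ulo uhi t x0) xb ->
  (forall x, reach_set ulo uhi t x0 x ->
     \sum_j eta j * x j 0 <= \sum_j eta j * xb j 0) ->
  xb = bang_point.
Proof.
move=> p0 pE clxb supp.
have dot_dev (u : R -> R) : {within `[0, t], continuous u} ->
    \sum_j eta j * bang_point j 0 - \sum_j eta j * endpoint t x0 u j 0 =
    dev u (fun s => p.[s]).
  move=> cu; rewrite -sumrB.
  under eq_bigr do rewrite -mulrBr bang_point_dev//.
  rewrite (_ : (fun s => p.[s]) =
      fun s => \sum_(j < n.+1) (eta \o inord) j * (w \o inord) j s); last first.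
    by apply/funext => s; rewrite pE; apply: eq_bigr => j _; rewrite /= inord_val.
  rewrite dev_sum// => [|j]; last exact: cw.
  by apply: eq_bigr => j _; rewrite /= inord_val.
have lohi s : 0 <= s <= t -> ulo s <= uhi s.
  move=> st; have [x [/reach_setP-/(_ t0)[u [_ bu _]] _]] := clxb setT filterT.
  by have /andP[h1 h2] := bu s st; exact: le_trans h2.
have [M M0 HM] := within_continuous_bounded (within_continuousB cuhi culo).
have uM s : 0 <= s <= t -> uhi s - ulo s <= M.
  by move=> /HM; exact: le_trans (ler_norm _).
have etab : \sum_j eta j * bang_point j 0 <= \sum_j eta j * xb j 0.
  apply/ler_addgt0Pr => d d0.
  have Mt : 0 < M * t + 1 by rewrite ltr_wpDl// mulr_ge0// ltW.
  have d1 : 0 < d / (M * t + 1) by rewrite divr_gt0.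
  have au := adm_soft_bang d1 lohi; have [cu bu] := au.
  have := supp (endpoint t x0 (soft_bang (d / (M * t + 1)))).
  move=> /(_ _)/wrap[]; first by apply/reach_setP => //; exists (soft_bang (d / (M * t + 1))).
  have := dev_soft_bang_le d1 lohi uM; rewrite -dot_dev//.
  have : M * (d / (M * t + 1)) * t <= d.
    rewrite (_ : _ * t = d * (M * t) / (M * t + 1)); last by ring.
    by rewrite ler_pdivrMr// ler_pM2l// lerDl.
  lra.
apply/colP => j; apply/eqP; rewrite eq_sym -subr_eq0 -normr_le0.
have [K K0 wK] := within_continuous_bounded (@cw j).
apply/ler_addgt0Pr => r r0; rewrite add0r.
have KM : 0 < K * M + 1 by rewrite ltr_wpDl// mulr_ge0.
have [|d d0 Id] := @Rint_resolvent_small R t p (r / 2 / (K * M + 1)) p0.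
  by rewrite !divr_gt0.
pose E := \sum_i `|eta i|.
have E0 : 0 <= E by rewrite sumr_ge0.
have KE : 0 < K * d^-1 * E + 1.
  by rewrite ltr_wpDl// !mulr_ge0// invr_ge0 ltW.
pose del := r / 2 / (K * d^-1 * E + 1).
have del0 : 0 < del by rewrite !divr_gt0.
have [x [/reach_setP-/(_ t0)[u [cu bu xu]] xball]] :=
  clxb (ball xb del) (nbhsx_ballx _ _ del0).
have {}xball i : `|xb i 0 - x i 0| <= del by have [_ /(_ i 0)/ltW] := xball.
have devp : dev u (fun s => p.[s]) <= E * del.
  rewrite -dot_dev// -xu; apply: (@le_trans _ _ (\sum_i eta i * (xb i 0 - x i 0))).
    by under [leRHS]eq_bigr do rewrite mulrBr; rewrite sumrB lerD2r.
  rewrite /E mulr_suml; apply: ler_sum => i _.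
  by rewrite (le_trans (ler_norm _))// normrM ler_wpM2l.
have := @dev_norm_le u (w j) K M d (conj cu bu) (@cw j) d0 K0 wK uM.
rewrite -bang_point_dev// -xu => Hdev.
rewrite (_ : _ - _ = (bang_point j 0 - x j 0) - (xb j 0 - x j 0)); last by ring.
apply: (le_trans (ler_normB _ _)).
apply: (@le_trans _ _ (K * (d^-1 * (E * del) + M * (r / 2 / (K * M + 1))) + del)).
  apply: lerD => //; apply: (le_trans Hdev); rewrite ler_wpM2l//.
  by rewrite lerD// ler_wpM2l// invr_ge0 ltW.
have -> : K * (d^-1 * (E * del) + M * (r / 2 / (K * M + 1))) + del =
    del * (K * d^-1 * E + 1) + (K * M) * (r / 2 / (K * M + 1)) by ring.
rewrite /del divfK ?gt_eqF// {3}(splitr r) lerD2l.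
by rewrite [leLHS]mulrA ler_pdivrMr//; lra.
Qed.

End BangBang.

Lemma weight_poly (R : realType) (n : nat) (t : R) (eta : 'I_n.+1 -> R) :
  (exists i, eta i != 0) ->
  exists p : {poly R}, [/\ p != 0, (size p <= n.+1)%N &
    forall s, p.[s] = \sum_j eta j * xi n (t - s) j 0].
Proof.
move=> [i0 ei0].
pose q := \poly_(k < n.+1) (eta (inord (n - k)) / k`!%:R).
have sX : size (t%:P - 'X : {poly R}) = 2%N.
  by rewrite -opprB size_polyN size_XsubC.
exists (q \Po (t%:P - 'X)); split.
- rewrite -size_poly_gt0 size_comp_poly2// size_poly_gt0.
  apply/eqP => /polyP/(_ (n - i0)%N); rewrite coef_poly coef0 ltnS leq_subr.
  rewrite subKn ?leq_ord// inord_val => /eqP; apply/negP.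
  by rewrite mulf_neq0// invr_eq0 pnatr_eq0 -lt0n fact_gt0.
- by rewrite size_comp_poly2//; exact: size_poly.
move=> s; rewrite horner_comp hornerD hornerN hornerC hornerX horner_poly.
rewrite (reindex_inj rev_ord_inj) /=; apply: eq_bigr => j _.
by rewrite mxE subSS subKn ?leq_ord// inord_val mulrAC mulrA.
Qed.

Lemma convex_reach_set (R : realType) (n : nat) (ulo uhi : R -> R) (t : R)
  (x0 : 'cV[R]_n.+1) : 0 < t -> convex_cV (reach_set ulo uhi t x0).
Proof.
move=> t0 _ _ a b /reach_setP-/(_ t0)[u [cu bu ->]] /reach_setP-/(_ t0)[v [cv bv ->]].
move=> a0 b0 ab; apply/reach_setP => //.
exists (fun s => a * u s + b * v s); split.
- by apply: within_continuousD; exact: within_continuousZ.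
- move=> s st; have /andP[u1 u2] := bu s st; have /andP[v1 v2] := bv s st.
  have -> : b = 1 - a by lra.
  have ? : 0 <= 1 - a by lra.
  by apply/andP; split; nra.
apply/colP => j; rewrite /endpoint !mxE.
have RE f : @Defs.Rint R 0 t (fun s => (f s *: xi n (t - s)) j 0) =
    @Defs.Rint R 0 t (fun s => f s * ((t - s) ^+ (n - j) / (n - j)`!%:R)).
  by apply: eq_Rint => s _; rewrite !mxE.
have cw : {within `[0, t], continuous (fun s : R => (t - s) ^+ (n - j) / (n - j)`!%:R)}.
  by apply: continuous_subspaceT; exact: continuous_taylor_coef.
rewrite !RE [X in _ = _ + X](@eq_Rint R 0 t _ (fun s => a * (u s * ((t - s) ^+ (n - j) / (n - j)`!%:R))
  + b * (v s * ((t - s) ^+ (n - j) / (n - j)`!%:R)))); last by move=> s _; ring.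
have cuw := within_continuousM cu cw; have cvw := within_continuousM cv cw.
rewrite Rint_add ?Rint_scale//; [|exact: within_continuousZ|exact: within_continuousZ].
set c := \sum_(_ < _ | _) _; have -> : b = 1 - a by lra.
ring.
Qed.

Theorem theorem2 (R : realType) (n : nat) (A : 'M[R]_n.+1) (b : 'cV[R]_n.+1)
  (vmin vmax : R) (z0 : 'cV[R]_n.+1) (t : R) :
  controllable A b -> distinct_eigenvalues A ->
  vmin <= vmax -> 0 < t ->
  let x0 := Mmat A b *m z0 in
  let ulo := umin A b vmin vmax z0 in
  let uhi := umax A b vmin vmax z0 in
  let mu := fun s => (uhi s - ulo s) / 2 in
  let nu := fun s => (uhi s + ulo s) / 2 in
  forall xb : 'cV[R]_n.+1,
    boundary (reach_set ulo uhi t x0) xb ->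
    exists (sg : 'I_n -> R) (eps : R),
      weyl t sg /\ (eps = 1 \/ eps = -1) /\
      xb = chi t x0 + Rintv 0 t (fun s => nu s *: xi n (t - s))
           + eps *: \sum_(i < n.+1)
               ((-1) ^+ i *: Rintv (sigext t sg i) (sigext t sg i.+1)
                              (fun s => mu s *: xi n (t - s))).
Proof.
move=> _ _ vv t0 x0 ulo uhi mu nu xb [clxb nint].
have culo : {within `[0, t], continuous ulo} by exact: continuous_umin.
have cuhi : {within `[0, t], continuous uhi} by exact: continuous_umax.
have [z [Xz _]] := clxb setT filterT.
have [|eta eta0 supp] := supporting_hyperplane (convex_reach_set t0) _ nint.
  by exists z.
have [p [p0 sp pE]] := weight_poly t eta0.
have [sg [e [wsg e1 tS tN psign]]] := poly_switching_times (ltW t0) p0 sp.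
exists sg, e; split => //; split => //.
exact: (boundary_is_bang_point t0 culo cuhi e1 tS tN psign p0 pE clxb supp).
Qed.
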